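(* Let $\Gamma$ be a group with a cobounded isometric action on a geodesic metric space $X$. Then the following assertions are equivalent. (1) $X$ is hyperbolic and the $\Gamma$-action is regular focal. (2) There exist an element $\alpha\in\Gamma$ and a subset $A\subset[\Gamma,\Gamma]$ such that: (a) the image of $\alpha$ in $\Gamma/[\Gamma,\Gamma]$ has infinite order; (b) the action of $\alpha$ on $[\Gamma,\Gamma]$ by conjugation is strictly confining into $A$; (c) setting $G=[\Gamma,\Gamma]\rtimes\langle\alpha\rangle$ (a subgroup of $\Gamma$) and $S=A\cup\{\alpha^{\pm 1}\}$, the inclusion map $(G,d_S)\to(\Gamma,d_x)$ is a quasi-isometry for some (hence every) $x\in X$. Moreover, if (2) holds, the Busemann character of $\Gamma$ in (1) is proportional, in restriction to $G$, to the obvious projection $G\to\langle\alpha\rangle\cong\mathbf{Z}$.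
   Context: No properness of $X$ and no topology on $\Gamma$ is assumed. For $x\in X$, $d_x$ is the pseudo-metric on $\Gamma$ given by $d_x(g,h)=d(gx,hx)$; $d_S$ is the word metric on $G$ associated with the generating set $S$. Confining: let $H$ be a group, $\alpha$ an automorphism of $H$ and $A\subset H$. The action of $\alpha$ is [strictly] confining into $A$ if: $\alpha(A)$ is [strictly] contained in $A$; $H=\bigcup_{n\ge 0}\alpha^{-n}(A)$; and $\alpha^{n_0}(A\cdot A)\subset A$ for some integer $n_0\ge 0$. Focal: an isometric action of $\Gamma$ on a hyperbolic space $X$ is focal if it fixes a unique point $\xi$ of the Gromov boundary $\partial X$ and some element acts as a hyperbolic isometry (an isometry $\phi$ is hyperbolic if $\lim_n \frac1n d(x,\phi^n x)>0$). Busemann quasicharacter: a horokernel based at $\xi\in\partial X$ is any accumulation point, for pointwise convergence, of functions $X\times X\to\mathbf{R}$, $(x,y)\mapsto d(x,x_n)-d(y,x_n)$, where $(x_n)$ is a sequence in $X$ converging to $\xi$. For any horokernel $h$ based at $\xi$ and any $x\in X$, the function $\beta_\xi(g)=\lim_{n\to\infty}\frac1n h(x,g^nx)$ is a well-defined homogeneous quasicharacter on the stabilizer of $\xi$, independent of $h$ and $x$, called the Busemann quasicharacter (Busemann character when it is a homomorphism). A focal action of $\Gamma$ with fixed point $\xi$ is regular focal if $\beta_\xi:\Gamma\to\mathbf{R}$ is a homomorphism.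
   Formalization: The word metric d_S uses words in the letters of S only, without adding inverses (the usual one when A is symmetric); with inverses added for non-symmetric A, (2)⇒(1) fails: Γ=R⋊Z, α acting by 1/2, A=[-1,∞), X the line with Γ acting through Z. *)

(* Defs.v *)
From mathcomp Require Import all_boot all_order all_algebra.
From mathcomp Require Import all_classical all_reals all_analysis.

Set Implicit Arguments.
Unset Strict Implicit.
Unset Printing Implicit Defensive.

Import Order.TTheory GRing.Theory Num.Theory.
Import numFieldNormedType.Exports.

Local Open Scope classical_set_scope.
Local Open Scope ring_scope.

Section Groups.
Variable Gam : groupType.
Implicit Types (H A S : set Gam) (phi : Gam -> Gam) (alpha g h : Gam).

Definition subgroup H : Prop :=
  [/\ H 1%g, forall g h, H g -> H h -> H (g * h)%g & forall g, H g -> H g^-1%g].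

Definition derived : set Gam :=
  smallest subgroup [set [~ p.1, p.2]%g | p in [set: Gam * Gam]].

Definition automorphism_on H phi : Prop :=
  set_bij H H phi /\
  forall g h, H g -> H h -> phi (g * h)%g = (phi g * phi h)%g.

(* [phi^-n(A)] is the set of the [h] in [H] such that [phi^n(h)] is in [A]. *)
Definition confining H phi A : Prop :=
  [/\ automorphism_on H phi,
      A `<=` H,
      phi @` A `<=` A,
      H = \bigcup_n [set h | H h /\ A (iter n phi h)] &
      exists n0 : nat,
        forall a b, A a -> A b -> A (iter n0 phi (a * b)%g)].

Definition strictly_confining H phi A : Prop :=
  confining H phi A /\ phi @` A `<` A.

(* [h |-> alpha h alpha^-1]; the library's [x ^ y] is [y^-1 x y]. *)
Definition conj_by alpha h : Gam := (alpha * h * alpha^-1)%g.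

Definition infinite_order_mod H alpha : Prop :=
  forall n : nat, (0 < n)%N -> ~ H (alpha ^+ n)%g.

Definition expgz g (n : int) : Gam :=
  match n with Posz k => (g ^+ k)%g | Negz k => (g ^- k.+1)%g end.

(* The internal product H <alpha>, as a subset of [Gam]. *)
Definition sdprod_cyc H alpha : set Gam :=
  [set (p.1 * expgz alpha p.2)%g | p in [set p : Gam * int | H p.1]].

Definition sdprod_gens A alpha : set Gam :=
  A `|` [set alpha; alpha^-1%g].

End Groups.

Section WordMetric.
Variables (R : realType) (Gam : groupType).

(* Letters are elements of S, without formal inverses, so S is meant to generate
   as a monoid; for S = S^-1 this is the usual word metric.  If phi : H -> H is
   conjugation by alpha and is confining into A, then the S below generates
   H <alpha> as a monoid even when A <> A^-1, as h is in alpha^-n A alpha^n for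
   some n.
   Adding the inverses of the letters for a non-symmetric A would be wrong: let
   Gam = R ><| Z with alpha acting on R by multiplication by 1/2, acting on the
   line by translations through Gam -> Z.  Then alpha is strictly confining
   into A = [-1, +oo[, and Gam with the length on A u -A u {alpha, alpha^-1} is
   quasi-isometric to the line, but both ends of the line are fixed. *)
Definition word_length (S : set Gam) (g : Gam) : R :=
  inf [set (size w)%:R | w in [set w : seq Gam |
        (forall s, s \in w -> S s) /\ (\big[*%g/1%g]_(s <- w) s) = g]].

Definition word_dist (S : set Gam) (g h : Gam) : R :=
  word_length S (g^-1 * h)%g.

End WordMetric.

(* [f] is a quasi-isometry from [(D, dT)] to the whole of [(U, dU)]. *)
Definition quasi_isometry (R : realType) (T U : Type) (D : set T)
    (dT : T -> T -> R) (dU : U -> U -> R) (f : T -> U) : Prop :=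
  exists L C : R, [/\ 1 <= L, 0 <= C,
    forall s t, D s -> D t ->
      L^-1 * dT s t - C <= dU (f s) (f t) /\ dU (f s) (f t) <= L * dT s t + C &
    forall u, exists2 s, D s & dU (f s) u <= C].

Section Hyperbolic.
Variables (R : realType) (X : metricType R).
Implicit Types (x y z o : X) (u v : nat -> X).

Definition geodesic_space : Prop :=
  forall x y, exists c : R -> X,
    [/\ c 0 = x, c (mdist x y) = y &
        {in `[0, mdist x y] &, forall s t, mdist (c s) (c t) = `|s - t|}].

Definition gromov_product o x y : R :=
  (mdist x o + mdist y o - mdist x y) / 2.

Definition hyperbolic_space : Prop :=
  exists2 delta : R, 0 <= delta &
    forall o x y z,
      Num.min (gromov_product o x y) (gromov_product o y z) - delta
      <= gromov_product o x z.

Definition gromov_equiv u v : Prop :=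
  forall o (M : R), exists N : nat, forall m n : nat,
    (N <= m)%N -> (N <= n)%N -> M <= gromov_product o (u m) (v n).

Definition gromov_sequence u : Prop := gromov_equiv u u.

(* A point of the boundary is an equivalence class of Gromov sequences; the
   sequences converging to xi are the elements of xi. *)
Definition gromov_boundary : set (set (nat -> X)) :=
  [set [set v | gromov_sequence v /\ gromov_equiv u v]
  | u in [set u | gromov_sequence u]].

Definition horofunctions u (n : nat) : {ptws (X * X) -> R} :=
  fun p => mdist p.1 (u n) - mdist p.2 (u n).

Definition horokernel (xi : set (nat -> X)) (h : {ptws (X * X) -> R}) : Prop :=
  exists2 u, xi u & cluster (horofunctions u @ \oo) h.

End Hyperbolic.

Section Actions.
Variables (R : realType) (X : metricType R) (Gam : groupType).
Variable act : Gam -> X -> X.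
Implicit Types (g h : Gam) (x y : X) (xi : set (nat -> X)) (beta : Gam -> R).

Definition isometric_action : Prop :=
  [/\ forall x, act 1%g x = x,
      forall g h x, act (g * h)%g x = act g (act h x) &
      forall g x y, mdist (act g x) (act g y) = mdist x y].

(* Forces X to be nonempty. *)
Definition cobounded : Prop :=
  exists x, exists r : R, forall y, exists g, mdist (act g x) y <= r.

Definition orbit_dist x g h : R := mdist (act g x) (act h x).

Definition hyperbolic_isometry (phi : X -> X) : Prop :=
  exists2 l : R, 0 < l &
    forall x, (fun n : nat => n%:R^-1 * mdist x (iter n phi x)) @ \oo --> l.

Definition fixes_boundary_point g xi : Prop :=
  [set act g \o u | u in xi] = xi.

Definition fixed_by_all xi : Prop :=
  gromov_boundary xi /\ forall g, fixes_boundary_point g xi.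

Definition focal_at xi : Prop :=
  [/\ fixed_by_all xi,
      forall eta, fixed_by_all eta -> eta = xi &
      exists g, hyperbolic_isometry (act g)].

(* [beta] is the Busemann quasicharacter at [xi], on the stabilizer of [xi]. *)
Definition busemann xi beta : Prop :=
  forall g, fixes_boundary_point g xi ->
  forall k, horokernel xi k -> forall x,
    (fun n : nat => n%:R^-1 * k (x, act (g ^+ n)%g x)) @ \oo --> beta g.

Definition regular_focal_at xi beta : Prop :=
  [/\ focal_at xi, busemann xi beta &
      forall g h, beta (g * h)%g = beta g + beta h].

Definition regular_focal : Prop := exists xi beta, regular_focal_at xi beta.

Definition inclusion_qi alpha (A : set Gam) x : Prop :=
  quasi_isometry (sdprod_cyc (@derived Gam) alpha)
    (word_dist R (sdprod_gens A alpha)) (orbit_dist x) id.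

Definition confining_pair alpha (A : set Gam) : Prop :=
  [/\ A `<=` @derived Gam,
      infinite_order_mod (@derived Gam) alpha,
      strictly_confining (@derived Gam) (conj_by alpha) A &
      exists x, inclusion_qi alpha A x].

End Actions.

(* Main.v *)
Require Import Defs.
From mathcomp Require Import all_boot all_order all_algebra.
From mathcomp Require Import all_classical all_reals all_analysis.
From mathcomp Require Import ring lra zify.

Set Implicit Arguments.
Unset Strict Implicit.
Unset Printing Implicit Defensive.

Import Order.TTheory GRing.Theory Num.Theory.
Import numFieldNormedType.Exports.

Local Open Scope classical_set_scope.
Local Open Scope ring_scope.

(** Write [H] for the derived subgroup and [G] for its product with the powers of
    [alpha]. Both implications come from the picture of a hyperbolic space seen
    from a boundary point [xi]: the geodesics that lead to [xi] merge, and the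
    level at which two of them have merged is an ultrametric, up to a bounded
    error.

    From focal to confining. A horokernel [k] at [xi] measures the levels, and
    [beta g] is [k (o, g o)] up to a bounded error. As [k] is unbounded and the
    action cobounded, [beta] is large at some [s] ([busemann_unbounded]). The
    elements of [H] preserve the levels, since [beta] is a homomorphism; so,
    beyond the point where the geodesics from [o] and [h o] to [xi] merge, [h]
    moves the points of the orbit of [s] by a bounded amount. In other words,
    conjugation by [alpha = s^-1] eventually brings every [h] into a fixed ball
    of [H] ([conj_contraction]), and it is confining into the union [A] of the
    images of this ball. If [A] were stable under the inverse of this
    conjugation, then [H] would have bounded orbits, and the other end of the
    orbit of [s] would be a second fixed point ([derived_unbounded]). The orbit
    of [G] is coarsely dense because an element with [beta] small is close to
    its commutator with a high power of [alpha], which belongs to [H]; the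
    quasi-isometry then follows as in the Milnor-Schwarz lemma
    ([inclusion_qi_of_local_words]).

    From confining to focal. Going down from [h * alpha ^ i] and
    [h' * alpha ^ j] along the powers of [alpha], one reaches neighbours as soon
    as conjugation by [alpha ^ n] brings [h^-1 * h'] into [A]. That [A * A] is
    absorbed by [A] says precisely that this merging level is an ultrametric up
    to a bounded error. The distance [model_dist] computed through the merging
    level is thus tree-like: it satisfies the four-point condition of Gromov up
    to an additive constant. It is comparable to the distance in the orbit, and
    [X] is geodesic, so [X] is hyperbolic, by a form of the Morse lemma for a
    target that is not geodesic ([quasi_geodesic_product_bounded],
    [hyperbolic_of_rough_model]). The points [alpha ^- n o] tend to a boundary
    point [xi], which [H] fixes. Another point fixed by [H] would bound the
    orbits of [H] ([displacement_bounded_of_fixes2]), hence put a conjugate of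
    the whole of [H] into [A], against strictness ([base_point_unique]). As [H]
    is normal, [xi] is then fixed by the whole group, and homogenizing
    [k (o, g o)] gives [beta], a homomorphism because [k (o, h o)] is bounded on
    [H] ([homogenization_hom]).

    As [beta] vanishes on [H], it is on [G] the multiple by [beta alpha] of the
    projection; [beta alpha] is nonzero because [k] is unbounded and the orbit
    of [G] is coarsely dense. *)

(** * The derived subgroup and the powers of an element *)

Section DerivedSubgroup.
Variable Gam : groupType.
Implicit Types (g h a b : Gam).

Lemma derived_subgroup : subgroup (@derived Gam).
Proof.
split=> [|g h hg hh|g hg] M hM; case: (hM) => -[h1 hmul hinv] _.
- exact: h1.
- by apply: hmul; [exact: hg | exact: hh].
- by apply: hinv; exact: hg.
Qed.

Lemma derived1 : derived (1%g : Gam). Proof. by case: derived_subgroup. Qed.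
Lemma derivedM g h : derived g -> derived h -> derived (g * h)%g.
Proof. by case: derived_subgroup => _ h1 _; exact: h1. Qed.
Lemma derivedV g : derived g -> derived g^-1%g.
Proof. by case: derived_subgroup => _ _; exact. Qed.

Lemma derivedR g h : derived [~ g, h]%g.
Proof. by move=> M [_]; apply; exists (g, h). Qed.

Lemma conj_byE g h : conj_by g h = (h ^ g^-1)%g.
Proof. by rewrite /conj_by conjgE invgK mulgA. Qed.

Lemma derivedJ g h : derived h -> derived (h ^ g)%g.
Proof.
have : @derived Gam `<=` [set h | derived (h ^ g)%g]; last exact.
apply: smallest_sub.
  split => /= [|a b ha hb|a ha]; rewrite ?conj1g ?conjMg ?conjVg.
  - exact: derived1.
  - exact: derivedM.
  - exact: derivedV.
by move=> _ [[a b] _ <-] /=; rewrite conjRg; exact: derivedR.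
Qed.

Lemma derived_conj_by g h : derived h -> derived (conj_by g h).
Proof. by rewrite conj_byE; exact: derivedJ. Qed.

Lemma conj_byM a b h : conj_by (a * b)%g h = conj_by a (conj_by b h).
Proof. by rewrite !conj_byE -conjgM invgM. Qed.

Lemma conj_by1 h : conj_by 1%g h = h.
Proof. by rewrite conj_byE invg1 conjg1. Qed.

Lemma conj_by_mul a g h : conj_by a (g * h)%g = (conj_by a g * conj_by a h)%g.
Proof. by rewrite !conj_byE conjMg. Qed.

Lemma conj_byV a h : conj_by a h^-1%g = (conj_by a h)^-1%g.
Proof. by rewrite !conj_byE conjVg. Qed.

Lemma iter_conj_by a n h : iter n (conj_by a) h = conj_by (a ^+ n)%g h.
Proof.
elim: n => [|n IH]; first by rewrite expg0 conj_by1.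
by rewrite iterS IH -conj_byM -expgS.
Qed.

Lemma conj_by_automorphism g : automorphism_on (@derived Gam) (conj_by g).
Proof.
split; last by move=> a b _ _; exact: conj_by_mul.
split; first by move=> h; exact: derived_conj_by.
- by move=> a b _ _; rewrite !conj_byE => /conjg_inj.
- move=> h hh; exists (conj_by g^-1%g h); first exact: derived_conj_by.
  by rewrite -conj_byM mulgV conj_by1.
Qed.

(** So [g] is as close to the commutator [[~ g^-1, a^-1]] as the conjugate of [g]
    by [a] is to the identity. *)
Lemma commgVV_mul a g : ([~ g^-1, a^-1]^-1 * g = (conj_by a g^-1)^-1)%g.
Proof. by rewrite invgR -conj_byV /conj_by /commg /conjg !invgK !mulgA mulgVK. Qed.

Lemma expMg_mod_derived g h n :
  exists2 c, derived c & ((g * h) ^+ n = g ^+ n * h ^+ n * c)%g.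
Proof.
elim: n => [|n [c dc IH]].
  by exists 1%g; [exact: derived1 | rewrite !expg0 !mulg1].
exists ([~ h, g ^+ n] ^ (h ^+ n) * c)%g.
  by apply: derivedM => //; apply: derivedJ; exact: derivedR.
rewrite expgS IH !expgS !mulgA; congr (_ * _)%g.
by rewrite !mulgK.
Qed.

Lemma expgz_add_nat g (m : int) (n : nat) :
  expgz g (m + n%:Z) = (expgz g m * g ^+ n)%g.
Proof.
elim: n => [|n IH]; first by rewrite addr0 expg0 mulg1.
rewrite expgSr mulgA -IH -addn1 PoszD addrA; move: (m + n%:Z) => {IH m}[m|[|m]].
- by rewrite -PoszD addn1 /= expgSr.
- by rewrite /= expg1 mulVg.
- have -> : Negz m.+1 + 1%:Z = Negz m by lia.
  by rewrite /= (expgS g m.+1) invgM mulgVK.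
Qed.

Lemma expgzD g (m n : int) : expgz g (m + n) = (expgz g m * expgz g n)%g.
Proof.
case: n => n; first exact: expgz_add_nat.
have := expgz_add_nat g (m + Negz n) n.+1.
have -> : m + Negz n + n.+1%:Z = m by lia.
by move=> -> /=; rewrite mulgK.
Qed.

Lemma expgzN g (m : int) : expgz g (- m) = (expgz g m)^-1%g.
Proof. by apply/esym/mulg1_eq; rewrite -expgzD subrr. Qed.

Lemma expgz0 g : expgz g 0 = 1%g. Proof. by []. Qed.
Lemma expgz_nat g (n : nat) : expgz g n = (g ^+ n)%g. Proof. by []. Qed.

Lemma sdprod_cyc_mem alpha h (n : int) : derived h ->
  sdprod_cyc (@derived Gam) alpha (h * expgz alpha n)%g.
Proof. by move=> dh; exists (h, n). Qed.

End DerivedSubgroup.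

(** * Homogenization of quasimorphisms *)

Section Homogenization.
Variables (R : realType) (Gam : groupType).

Lemma eq0_of_multiples_bounded (x C : R) : (forall n : nat, `|n%:R * x| <= C) -> x = 0.
Proof.
move=> h; apply: contrapT => /eqP x0; have x1 : 0 < `|x| by rewrite normr_gt0.
have := h (Num.truncn (C / `|x|)).+1; rewrite normrM normr_nat.
by apply/negP; rewrite -ltNge -ltr_pdivrMr // truncnS_gt.
Qed.

Lemma cvg_average (a : nat -> R) (l D : R) :
  (forall n, `|a n - n%:R * l| <= D) -> (fun n => n%:R^-1 * a n) @ \oo --> l.
Proof.
move=> h; apply/cvgrPdist_le => e e0.
have D0 : 0 <= D by apply: le_trans (h 0%N).
exists (Num.truncn (D / e)).+1 => // n /= hn.
have n0 : 0 < n%:R :> R by rewrite ltr0n; case: n hn.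
have hDn : D <= e * n%:R.
  rewrite mulrC -ler_pdivrMr //; apply/ltW/(lt_le_trans (truncnS_gt _)).
  by rewrite ler_nat.
have -> : l - n%:R^-1 * a n = - (n%:R^-1 * (a n - n%:R * l)).
  by field; rewrite gt_eqF.
rewrite normrN normrM normfV (ger0_norm (ltW n0)) mulrC ler_pdivrMr //.
exact: le_trans (h n) hDn.
Qed.

Definition quasimorphism (b : Gam -> R) (D : R) : Prop :=
  forall g h, `|b (g * h)%g - b g - b h| <= D.

Variables (b : Gam -> R) (D : R).
Hypothesis b_quasi : quasimorphism b D.

Lemma quasimorphism_exp g (m n : nat) :
  `|b (g ^+ (m * n.+1))%g - n.+1%:R * b (g ^+ m)%g| <= n%:R * D.
Proof.
elim: n => [|n IH]; first by rewrite muln1 mul1r subrr normr0 mul0r.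
have := b_quasi (g ^+ m)%g (g ^+ (m * n.+1))%g; rewrite -expgnDr -mulnS.
move: IH; move: (b (g ^+ (m * n.+1))%g) (b (g ^+ (m * n.+2))%g) => p q.
rewrite -!natr1 => /ler_normlP[? ?] /ler_normlP[? ?].
by apply/ler_normlP; split; lra.
Qed.

(** The homogenization of a quasimorphism [b]: the bounds
    [(b (g ^+ n) - D) / n] and [(b (g ^+ m) + D) / m] are always in this order,
    so they have a number [beta g] between them. *)
Lemma homogenization : exists beta : Gam -> R,
  forall g n, `|b (g ^+ n)%g - n%:R * beta g| <= D.
Proof.
suff /choice[beta hbeta] : forall g, exists l : R, forall n,
    `|b (g ^+ n)%g - n%:R * l| <= D.
  by exists beta.
move=> g; pose lo (n : nat) := (b (g ^+ n.+1)%g - D) / n.+1%:R.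
pose hi (n : nat) := (b (g ^+ n.+1)%g + D) / n.+1%:R.
have lohi m n : lo m <= hi n.
  rewrite /lo /hi ler_pdivrMr ?ltr0n // mulrAC ler_pdivlMr ?ltr0n //.
  have := quasimorphism_exp g n.+1 m; have := quasimorphism_exp g m.+1 n.
  rewrite mulnC; move: (b (g ^+ (n.+1 * m.+1))%g) (b (g ^+ n.+1)%g) (b (g ^+ m.+1)%g).
  move=> p q r; rewrite -!natr1 => /ler_normlP[? ?] /ler_normlP[? ?].
  have D0 : 0 <= D by apply: le_trans (b_quasi g g).
  by lra.
have hs : has_sup (range lo).
  by split; [exists (lo 0%N), 0%N | exists (hi 0%N) => _ [m _ <-]].
exists (sup (range lo)) => -[|n].
  have := b_quasi 1%g 1%g; rewrite expg0 mulg1 mul0r subr0.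
  by rewrite addrAC subrr add0r normrN.
have h1 : lo n <= sup (range lo) by apply: ub_le_sup; [case: hs | exists n].
have h2 : sup (range lo) <= hi n by apply: ge_sup; [case: hs | move=> _ [m _ <-]].
move: h1 h2; rewrite /lo /hi ler_pdivrMr ?ltr0n // ler_pdivlMr ?ltr0n // => ? ?.
by apply/ler_normlP; split; lra.
Qed.

(** [(g * h) ^+ n] and [g ^+ n * h ^+ n] differ by an element of the derived
    subgroup, where [b] is bounded: so [n] times the defect of additivity of
    [beta] is bounded in [n]. *)
Lemma homogenization_hom (beta : Gam -> R) (D' C : R) :
  (forall g n, `|b (g ^+ n)%g - n%:R * beta g| <= D') ->
  (forall c, derived c -> `|b c| <= C) ->
  forall g h, beta (g * h)%g = beta g + beta h.
Proof.
move=> hbeta hC g h; apply/eqP; rewrite -subr_eq0; apply/eqP.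
apply: (@eq0_of_multiples_bounded _ (C + 2 * D + 3 * D')) => n.
have [c /hC hc E] := expMg_mod_derived g h n.
have := hbeta (g * h)%g n; have := hbeta g n; have := hbeta h n.
have := b_quasi (g ^+ n)%g (h ^+ n)%g; have := b_quasi (g ^+ n * h ^+ n)%g c.
rewrite -E; move: hc => /ler_normlP[? ?] /ler_normlP[? ?] /ler_normlP[? ?].
move=> /ler_normlP[? ?] /ler_normlP[? ?] /ler_normlP[? ?].
by apply/ler_normlP; split; lra.
Qed.

End Homogenization.

(** * Quasi-geodesics and the four-point condition *)

Section RoughHyperbolic.
Variables (R : realType) (T : Type).
Implicit Types (rho : T -> T -> R) (delta L : R) (c : R -> T) (x y z w : T).

(** The four-point condition of Gromov, for a function that satisfies the triangle
    inequality only up to [delta]. *)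
Definition rough_hyperbolic rho delta : Prop :=
  [/\ 0 <= delta, forall x, rho x x = 0, forall x y, rho x y = rho y x,
      forall x y, 0 <= rho x y &
      forall x y z w, rho x y + rho z w <=
        Num.max (rho x z + rho y w) (rho x w + rho y z) + delta].

Definition rough_product rho o x y : R := (rho x o + rho y o - rho x y) / 2.

Definition quasi_geodesic rho L c (l : R) : Prop :=
  forall s t : R, 0 <= s <= l -> 0 <= t <= l ->
    rho (c s) (c t) <= L * `|s - t| + L /\ `|s - t| <= L * rho (c s) (c t) + L.

Variables (rho : T -> T -> R) (delta L : R).
Hypothesis rhoH : rough_hyperbolic rho delta.
Hypothesis L1 : 1 <= L.

Let rho_xx x : rho x x = 0. Proof. by case: rhoH. Qed.
Let rhoC x y : rho x y = rho y x. Proof. by case: rhoH. Qed.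
Let rho_ge0 x y : 0 <= rho x y. Proof. by case: rhoH. Qed.
Let L0 : 0 <= L. Proof. exact: le_trans L1. Qed.
Let delta_ge0 : 0 <= delta. Proof. by case: rhoH. Qed.

Lemma rough_four_point x y z w :
  rho x y + rho z w <= rho x z + rho y w + delta \/
  rho x y + rho z w <= rho x w + rho y z + delta.
Proof.
case: rhoH => _ _ _ _ /(_ x y z w).
by rewrite /Num.max; case: ifP => _; [right | left].
Qed.

Lemma rough_triangle z x y : rho x y <= rho x z + rho z y + delta.
Proof.
by case: (rough_four_point x y z z); rewrite rho_xx (rhoC y z); lra.
Qed.

Lemma rough_product_ge x y z : - (delta / 2) <= rough_product rho z x y.
Proof.
by have := rough_triangle z x y; rewrite /rough_product (rhoC z y); lra.
Qed.

Lemma rough_product_min o x y z (B : R) :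
  rough_product rho o x z <= B ->
  rough_product rho o x y <= B + delta / 2 \/
  rough_product rho o y z <= B + delta / 2.
Proof.
rewrite /rough_product => h.
case: (rough_four_point x z y o); rewrite ?(rhoC z y) => ?; [left|right]; lra.
Qed.

(** A virtual point, given by its distances [F] to the points of [T]. The centre
    of a tripod need not exist in [T], but it does as a virtual point: its
    distance function in a tree is the maximum of the distances to the three
    ends, each diminished by the length of its leg. *)
Definition rough_point (F : T -> R) : Prop :=
  forall x y z, F y + rho x z <= F x + rho y z + delta \/
                F y + rho x z <= F z + rho x y + delta.

Lemma rough_point_max (F G : T -> R) :
  rough_point F -> rough_point G -> rough_point (fun x => Num.max (F x) (G x)).
Proof.
move=> hF hG x y z.
have h (a b : R) : a <= Num.max a b /\ b <= Num.max a b.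
  by rewrite !le_max !lexx orbT.
have [? ?] := h (F x) (G x); have [? ?] := h (F z) (G z).
rewrite {1 3}/Num.max; case: ifP => _.
- by case: (hG x y z) => ?; [left|right]; lra.
- by case: (hF x y z) => ?; [left|right]; lra.
Qed.

Lemma rough_point_dist a r : rough_point (fun x => rho a x - r).
Proof.
move=> x y z; case: (rough_four_point a y x z) => ?; [left|right]; first lra.
by rewrite (rhoC x y); lra.
Qed.

Lemma rough_point_lip F y z : rough_point F -> F y <= F z + rho y z + delta.
Proof. by move=> /(_ z y z); rewrite rho_xx (rhoC z y); case; lra. Qed.

(** By bisection: the product of the ends seen from [F] is, up to [delta], at
    least the product of the ends of one of the two halves. *)
Lemma path_near_point (F : T -> R) c (l : R) (k : nat) (a b : R) :
  rough_point F -> quasi_geodesic rho L c l ->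
  0 <= a -> a <= b -> b <= l -> b - a <= 2 ^+ k ->
  exists i, a <= i <= b /\
    F (c i) <= (F (c a) + F (c b) - rho (c a) (c b)) / 2
               + k%:R * delta + 2 * L + delta.
Proof.
have d0 := delta_ge0; have L0' := L0.
move=> hF hc; elim: k a b => [|k IH] a b a0 ab bl hk.
  exists a; split; first by rewrite lexx.
  have hab : rho (c a) (c b) <= L * 1 + L.
    have [||h _] := hc a b; [by apply/andP; split; lra|by apply/andP; split; lra|].
    rewrite expr0 in hk; apply: (le_trans h); rewrite lerD2r.
    by apply: ler_wpM2l => //; rewrite distrC ger0_norm; lra.
  have := rough_point_lip (c a) (c b) hF.
  by rewrite mul0r; lra.
have [e eE] : exists e, e = (a + b) / 2 by eexists.
have hke : (b - a) / 2 <= 2 ^+ k.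
  by rewrite ler_pdivrMr // -exprSr.
have kS : k.+1%:R * delta = k%:R * delta + delta by rewrite -natr1; ring.
case: (hF (c a) (c e) (c b)) => h.
- case: (IH e b) => [||||i [hi Fi]]; try lra.
  by exists i; split; [lra | rewrite kS; lra].
- case: (IH a e) => [||||i [hi Fi]]; try lra.
  by exists i; split; [lra | rewrite kS; lra].
Qed.


(** The products of the points of a quasi-geodesic grow at most
    logarithmically: the two halves of the path, on both sides of [c t], pass
    close to the centre [F] of the tripod spanned by [c s], [c t] and [c u],
    hence close to each other, and a quasi-geodesic cannot make such a detour
    around [c t] unless [c t] is close to the centre too. *)
Lemma quasi_geodesic_product_log : exists2 C : R, 0 <= C &
  forall c (l : R) (k : nat) (s t u : R), quasi_geodesic rho L c l ->
    0 <= s -> s <= t -> t <= u -> u <= l -> u - s <= 2 ^+ k ->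
    rough_product rho (c t) (c s) (c u) <= C * k%:R + C.
Proof.
have d0 := delta_ge0; have L0' := L0; have L1' := L1.
have L2 : 0 <= L ^+ 2 by exact: exprn_ge0.
exists ((L ^+ 2 + 1) * (5 * L + 8 * delta)); first by apply: mulr_ge0; lra.
move=> c l k s t u hc s0 st tu ul hk.
pose rs := rough_product rho (c s) (c t) (c u).
pose rt := rough_product rho (c t) (c s) (c u).
pose ru := rough_product rho (c u) (c s) (c t).
have [rsE rtE ruE] : [/\ rs + rt = rho (c s) (c t), rt + ru = rho (c t) (c u)
    & rs + ru = rho (c s) (c u)].
  rewrite /rs /rt /ru /rough_product (rhoC (c t) (c s)) (rhoC (c u) (c s)).
  by rewrite (rhoC (c u) (c t)); split; lra.
have rs_ge : - (delta / 2) <= rs by exact: rough_product_ge.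
have rt_ge : - (delta / 2) <= rt by exact: rough_product_ge.
have ru_ge : - (delta / 2) <= ru by exact: rough_product_ge.
pose F x := Num.max (Num.max (rho (c s) x - rs) (rho (c u) x - ru))
                    (rho (c t) x - rt).
have hF : rough_point F.
  by do 2?apply: rough_point_max; exact: rough_point_dist.
have F_ge x : [/\ rho (c s) x - rs <= F x, rho (c u) x - ru <= F x &
    rho (c t) x - rt <= F x].
  by rewrite /F !le_max !lexx !orbT.
have F_le x (B : R) : rho (c s) x - rs <= B -> rho (c u) x - ru <= B ->
    rho (c t) x - rt <= B -> F x <= B.
  by rewrite /F !ge_max => -> -> ->.
have Fs : F (c s) <= rs + delta.
  by apply: F_le; rewrite ?rho_xx ?(rhoC (c u)) ?(rhoC (c t)); lra.
have Ft : F (c t) <= rt + delta.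
  by apply: F_le; rewrite ?rho_xx ?(rhoC (c u) (c t)); lra.
have Fu : F (c u) <= ru + delta.
  by apply: F_le; rewrite ?rho_xx ?(rhoC (c u)); lra.
have [|||| i [/andP[ti iu] Fi]] :=
  path_near_point (k := k) (a := t) (b := u) hF hc; try lra.
have [|||| j [/andP[sj jt] Fj]] :=
  path_near_point (k := k) (a := s) (b := t) hF hc; try lra.
set B := k%:R * delta + 2 * L + 2 * delta.
have FiB : F (c i) <= B by rewrite /B; lra.
have FjB : F (c j) <= B by rewrite /B; lra.
have dij : rho (c i) (c j) <= 2 * B + delta.
  have [h1 h2 _] := F_ge (c i); have [h3 h4 _] := F_ge (c j).
  by case: (rough_four_point (c i) (c j) (c s) (c u));
    rewrite ?(rhoC (c i) (c s)) ?(rhoC (c j) (c s)) ?(rhoC (c i) (c u))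
      ?(rhoC (c j) (c u)); lra.
have [||_ hij] := hc i j; [by apply/andP; split; lra..|].
have [||hit _] := hc i t; [by apply/andP; split; lra..|].
rewrite ger0_norm in hij; last lra.
rewrite ger0_norm in hit; last lra.
have k0 : 0 <= k%:R :> R by [].
have rtF : rt <= F (c t) by have [h _ _] := F_ge (c t); lra.
have Fti := rough_point_lip (c t) (c i) hF.
rewrite (rhoC (c t)) in Fti.
have kd : 0 <= k%:R * delta by exact: mulr_ge0.
have kL : 0 <= k%:R * L by exact: mulr_ge0.
have B0 : 0 <= B by rewrite /B; lra.
have h1 : L * (i - t) <= L * (L * (2 * B + delta) + L).
  apply: ler_wpM2l => //; have : L * rho (c i) (c j) <= L * (2 * B + delta).
    exact: ler_wpM2l.
  by lra.
have h2 : rt <= (L ^+ 2 + 1) * (2 * B + 2 * delta + L).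
  have : 0 <= L ^+ 2 * (delta + L - 1) by apply: mulr_ge0 => //; lra.
  by lra.
apply: le_trans h2 _.
have -> : (L ^+ 2 + 1) * (5 * L + 8 * delta) * k%:R +
    (L ^+ 2 + 1) * (5 * L + 8 * delta) =
    (L ^+ 2 + 1) * ((5 * L + 8 * delta) * (k%:R + 1)) by ring.
by apply: ler_wpM2l; [exact: addr_ge0 | rewrite /B; lra].
Qed.

End RoughHyperbolic.

Lemma linear_le_exp2 (R : realType) (a b : R) :
  exists k0 : nat, forall k : nat, (k0 <= k)%N -> a * k%:R + b <= 2 ^+ k.
Proof.
have sq (k : nat) : ((k + 4) ^ 2 <= 2 ^ (k + 4))%N.
  elim: k => // k; rewrite !addSn (expnS 2); move: (2 ^ _)%N => m.
  by rewrite !expnS !expn0; nia.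
have ab0 : 0 <= `|a| + `|b| by exact: addr_ge0.
exists (4 + Num.truncn (`|a| + `|b|))%N => k hk.
have k4 : (4 <= k)%N by apply: leq_trans hk; exact: leq_addr.
have k1 : 1 <= k%:R :> R by rewrite ler1n; apply: leq_trans k4.
have kab : `|a| + `|b| <= k%:R.
  have := truncnS_gt (`|a| + `|b|) => /ltW h; apply: le_trans h _.
  by rewrite ler_nat; apply: leq_trans hk; rewrite -addn1 addnC leq_add2r.
have hsq : k%:R * k%:R <= 2 ^+ k :> R.
  have := sq (k - 4)%N; rewrite subnK // => h.
  by rewrite -natrM mulnn -natrX ler_nat.
apply: le_trans hsq.
have ha := ler_norm a; have hb := ler_norm b.
have h1 : a * k%:R <= `|a| * k%:R by exact: ler_wpM2r.
have h2 : `|b| * 1 <= `|b| * k%:R by exact: ler_wpM2l.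
have h3 : (`|a| + `|b|) * k%:R <= k%:R * k%:R by exact: ler_wpM2r.
by lra.
Qed.

Lemma unit_subdivision (R : realType) (D : R) : 0 <= D ->
  exists (N : nat) (t : nat -> R), [/\ N%:R <= D + 1, t 0%N = 0, t N = D,
    forall i, (i <= N)%N -> 0 <= t i <= D & forall i, `|t i - t i.+1| <= 1].
Proof.
move=> D0; pose N := (Num.truncn D).+1; exists N, (fun i => D * (i%:R / N%:R)).
have N0 : 0 < N%:R :> R by rewrite ltr0n.
split=> [||| i iN|i].
- by rewrite /N -natr1 lerD2r Num.Theory.truncn_le.
- by rewrite mul0r mulr0.
- by rewrite divff ?mulr1 // gt_eqF.
- rewrite mulr_ge0 ?divr_ge0 //=.
  by rewrite -[leRHS]mulr1 ler_wpM2l // ler_pdivrMr // mul1r ler_nat.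
- rewrite -mulrBr -mulrBl -natr1 opprD addNKr mulN1r mulrN normrN.
  rewrite ger0_norm ?mulr_ge0 ?invr_ge0 // ler_pdivrMr // mul1r.
  exact/ltW/truncnS_gt.
Qed.

(** The hypothesis says that [m] is at most logarithmic in [a * m + b], and powers
    of 2 overtake affine functions. *)
Lemma log_self_bound (R : realType) (a b C : R) : 0 <= a -> 0 <= C ->
  exists M : R, forall m : R,
    (forall k : nat, a * m + b <= 2 ^+ k -> m <= C * k%:R + C) -> m <= M.
Proof.
move=> a0 C0; have [k0 hk0] := linear_le_exp2 (a * C) (a * (2 * C) + b).
exists (C * k0%:R + C) => m hm.
have exk : exists k : nat, a * m + b <= 2 ^+ k.
  exists (Num.truncn (`|a * m + b|)).+1; apply: le_trans (ler_norm _) _.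
  apply: le_trans (ltW (truncnS_gt _)) _.
  by rewrite -natrX ler_nat ltnW // ltn_expl.
(* the least [k] has [2 ^ (k - 1) < a * m + b], while [m] is at most linear in
   [k] *)
case: (ex_minnP exk) => k hk kmin.
have [kk0|k0k] := leqP k k0.
  apply: le_trans (hm _ hk) _; rewrite lerD2r; apply: ler_wpM2l => //.
  by rewrite ler_nat.
case: k => // k in hk kmin k0k *.
have h := hk0 k k0k; have hmk := hm _ hk.
have : ~~ (a * m + b <= 2 ^+ k) by apply: contraT => /negPn /kmin; rewrite ltnn.
rewrite -ltNge => hlt.
have : a * m <= a * (C * k.+1%:R + C) by exact: ler_wpM2l.
by rewrite -natr1; lra.
Qed.

Section QuasiGeodesics.
Variables (R : realType) (T : Type) (rho : T -> T -> R) (delta L : R).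
Hypothesis rhoH : rough_hyperbolic rho delta.
Hypothesis L1 : 1 <= L.

Let rho_xx x : rho x x = 0. Proof. by case: rhoH. Qed.
Let rhoC x y : rho x y = rho y x. Proof. by case: rhoH. Qed.
Let rho_ge0 x y : 0 <= rho x y. Proof. by case: rhoH. Qed.
Let L0 : 0 <= L. Proof. exact: le_trans L1. Qed.
Let delta_ge0 : 0 <= delta. Proof. by case: rhoH. Qed.

Lemma rough_productC o x y : rough_product rho o x y = rough_product rho o y x.
Proof. by rewrite /rough_product (rhoC x y); lra. Qed.

Lemma quasi_geodesic_far c (l r s t : R) : quasi_geodesic rho L c l ->
  0 <= s <= l -> 0 <= t <= l -> L * (r + 1) <= `|s - t| -> r <= rho (c s) (c t).
Proof.
move=> hc hs ht hr; have [_ h] := hc s t hs ht.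
have L0' : 0 < L by exact: lt_le_trans L1.
by rewrite -(ler_pM2l L0'); lra.
Qed.

(** As [c v] is between [c s] and [c t], the product of [c s] and [c v] seen from
    [c t] is about the distance from [c v] to [c t], too large to be the smaller
    one in the inequality of products for [c v], [c s] and [u]. *)
Lemma rough_product_shorten c (l m s t v : R) (u : T) :
  quasi_geodesic rho L c l -> 0 <= s <= l -> 0 <= t <= l -> 0 <= v <= l ->
  L * (2 * m + delta + 2) <= `|v - t| ->
  rough_product rho (c v) (c s) (c t) <= m ->
  rough_product rho (c t) (c v) u <= m ->
  rough_product rho (c t) (c s) u <= rough_product rho (c t) (c v) u + delta / 2.
Proof.
move=> hc hs ht hv far h1 h2; have d0 := delta_ge0.
have vt : 2 * m + delta + 1 <= rho (c v) (c t).
  by apply: (quasi_geodesic_far hc) => //; lra.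
case: (rough_product_min rhoH (c s) (lexx (rough_product rho (c t) (c v) u)))
  => // h3; exfalso.
move: h1 h3; rewrite /rough_product (rhoC (c s) (c v)) (rhoC (c t) (c v)).
by move: h2; rewrite /rough_product; lra.
Qed.

(** Morse lemma: by the logarithmic bound for the stretch of [c] around [c t] of
    length comparable to the largest product [m], which has the same product up
    to [delta], [m] is at most logarithmic in [m]. *)
Lemma quasi_geodesic_product_bounded : exists2 K : R, 0 <= K &
  forall c (l s t u : R), quasi_geodesic rho L c l ->
    0 <= s -> s <= t -> t <= u -> u <= l ->
    rough_product rho (c t) (c s) (c u) <= K.
Proof.
have d0 := delta_ge0; have L0' := L0.
have [C C0 hC] := quasi_geodesic_product_log rhoH L1.
have [||M hM] := @log_self_bound R (4 * L) (2 * L * (delta + 2)) (C + delta).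
- by lra.
- by lra.
exists (Num.max 0 M) => [|c l s t u hc s0 st tu ul]; first by rewrite le_max lexx.
rewrite le_max; apply/orP; right.
have l0 : 0 <= l by lra.
pose E := [set p : R | exists s t u, [/\ 0 <= s, s <= t, t <= u, u <= l &
  p = rough_product rho (c t) (c s) (c u)]].
have Es : has_sup E.
  split; first by exists (rough_product rho (c t) (c s) (c u)), s, t, u.
  exists (L * l + L) => _ [s' [t' [u' [h1 h2 h3 h4 ->]]]].
  have hl (a b : R) : 0 <= a -> a <= b -> b <= l -> rho (c a) (c b) <= L * l + L.
    move=> ha hab hb; have [||h _] := hc a b; [by apply/andP; split; lra..|].
    apply: le_trans h _; rewrite lerD2r; apply: ler_wpM2l => //.
    by rewrite distrC ger0_norm; lra.
  have := hl s' t' h1 h2 (le_trans h3 h4).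
  have := hl t' u' (le_trans h1 h2) h3 h4.
  by have := rho_ge0 (c s') (c u'); rewrite /rough_product (rhoC (c u')); lra.
set m := sup E.
have Em (a b d : R) : 0 <= a -> a <= b -> b <= d -> d <= l ->
    rough_product rho (c b) (c a) (c d) <= m.
  by move=> h1 h2 h3 h4; apply: ub_le_sup; [case: Es | exists a, b, d].
have m0 : 0 <= m.
  have := Em 0 0 0 (lexx _) (lexx _) (lexx _) l0.
  by rewrite /rough_product !rho_xx; lra.
suff : m <= M by apply: le_trans; exact: Em.
apply: hM => k hk; apply: ge_sup; first by case: Es.
move=> _ [{}s [{}t [{}u [{}s0 {}st {}tu {}ul ->]]]].
set r := L * (2 * m + delta + 2).
have r0 : 0 <= r by apply: mulr_ge0 => //; lra.
have [v [sv vt vr hv]] : exists v, [/\ s <= v, v <= t, t - v <= r &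
    rough_product rho (c t) (c s) (c u)
      <= rough_product rho (c t) (c v) (c u) + delta / 2].
  have [h|h] := leP (t - s) r; first by exists s; split; lra.
  exists (t - r); split; [lra..|].
  apply: (rough_product_shorten (m := m) hc) => //; try by apply/andP; split; lra.
  - by rewrite -/r distrC ger0_norm; lra.
  - by apply: Em; lra.
  - by apply: Em; lra.
have [w [tw wu wr hw]] : exists w, [/\ t <= w, w <= u, w - t <= r &
    rough_product rho (c t) (c v) (c u)
      <= rough_product rho (c t) (c v) (c w) + delta / 2].
  have [h|h] := leP (u - t) r; first by exists u; split; lra.
  exists (t + r); split; [lra..|].
  rewrite ![rough_product _ _ (c v) _]rough_productC.
  apply: (rough_product_shorten (m := m) hc) => //; try by apply/andP; split; lra.
  - by rewrite -/r ger0_norm; lra.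
  - by rewrite rough_productC; apply: Em; lra.
  - by rewrite rough_productC; apply: Em; lra.
have k0 : 0 <= k%:R :> R by [].
have kd : 0 <= delta * k%:R by exact: mulr_ge0.
have := hC c l k v t w hc; rewrite /r in vr wr.
move=> /(_ ltac:(lra) ltac:(lra) ltac:(lra) ltac:(lra) ltac:(lra)).
by lra.
Qed.

(** The product, seen from [o], of a point of [c] with one of the two ends is at
    most that of the ends, up to [delta]. Where this role passes from one end to
    the other, both products are small, which bounds the distance to [o]. *)
Lemma quasi_geodesic_near : exists2 C : R, 0 <= C &
  forall c (l : R) o, quasi_geodesic rho L c l -> 0 <= l ->
    exists2 t, 0 <= t <= l &
      rho o (c t) <= rough_product rho o (c 0) (c l) + C.
Proof.
have d0 := delta_ge0; have L0' := L0.
have [K K0 hK] := quasi_geodesic_product_bounded.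
exists (2 * (2 * L + 2 * delta) + K) => [|c l o hc l0]; first by lra.
set Q := rough_product rho o (c 0) (c l) + delta / 2.
have [N [tt [_ tt0 ttN tt_in tt_step]]] := unit_subdivision l0.
have [t [t' [ht ht' tt' hl hr]]] : exists t t', [/\ 0 <= t <= l, 0 <= t' <= l,
    `|t - t'| <= 1, rough_product rho o (c t) (c l) <= Q &
    rough_product rho o (c 0) (c t') <= Q].
  apply: contrapT => hn.
  have hP i : (i <= N)%N -> rough_product rho o (c (tt i)) (c l) <= Q.
    elim: i => [_|i IH iN]; first by rewrite tt0 /Q; lra.
    apply: contrapT => hni; apply: hn; exists (tt i), (tt i.+1).
    split; [exact/tt_in/ltnW | exact: tt_in | exact: tt_step
      | exact/IH/ltnW |].
    by case: (rough_product_min rhoH (c (tt i.+1))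
      (lexx (rough_product rho o (c 0) (c l)))).
  apply: hn; exists l, l; have hN := hP N (leqnn N); rewrite ttN in hN.
  split; rewrite ?subrr ?normr0 ?l0 ?lexx //.
  by rewrite /Q; lra.
exists t => //.
have htK : rough_product rho (c t) (c 0) (c l) <= K.
  by case/andP: ht => ? ?; apply: (hK c l).
have dtt' : rho (c t) (c t') <= 2 * L.
  have [h _] := hc t t' ht ht'; apply: le_trans h _.
  by have : L * `|t - t'| <= L * 1 by [exact: ler_wpM2l]; lra.
have h1 := rough_triangle rhoH (c t') o (c t).
have h2 := rough_triangle rhoH (c t) (c 0) (c t').
move: hl hr htK; rewrite /Q /rough_product (rhoC (c t) o) (rhoC (c t') o).
rewrite (rhoC (c l) (c t)); rewrite (rhoC (c t') (c t)) in h1.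
by lra.
Qed.

End QuasiGeodesics.

(** * Quasi-isometry invariance of hyperbolicity *)

Section MetricFacts.
Variables (R : realType) (X : metricType R).
Implicit Types (x y z o : X).

Lemma gromov_productC o x y : gromov_product o x y = gromov_product o y x.
Proof. by rewrite /gromov_product (metric_sym x y) [mdist x o + _]addrC. Qed.

Definition is_geodesic (c : R -> X) x y : Prop :=
  [/\ c 0 = x, c (mdist x y) = y &
      {in `[0, mdist x y] &, forall s t, mdist (c s) (c t) = `|s - t|}].

Lemma geodesic_split c x y (t : R) : is_geodesic c x y -> 0 <= t <= mdist x y ->
  mdist x (c t) = t /\ mdist (c t) y = mdist x y - t.
Proof.
case=> c0 c1 hc ht; have /andP[t0 t1] := ht.
have h0 : 0 \in `[0, mdist x y] by rewrite in_itv /= lexx mdist_ge0.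
have h1 : mdist x y \in `[0, mdist x y] by rewrite in_itv /= lexx mdist_ge0.
have h : t \in `[0, mdist x y] by rewrite in_itv /=.
split; first by rewrite -{1}c0 hc // distrC subr0 ger0_norm.
by rewrite -{1}c1 hc // distrC ger0_norm // subr_ge0.
Qed.

Lemma gromov_product_le_dist c x y o (t : R) : is_geodesic c x y ->
  0 <= t <= mdist x y -> gromov_product o x y <= mdist o (c t).
Proof.
move=> hc /(geodesic_split hc) [h1 h2].
have := metric_triangle x (c t) o; have := metric_triangle y (c t) o.
by rewrite /gromov_product (metric_sym y (c t)) (metric_sym o); lra.
Qed.

End MetricFacts.

Section QuasiIsometryInvariance.
Variables (R : realType) (X : metricType R).
Hypothesis X_geodesic : geodesic_space X.
Implicit Types (x y z o : X).

(** Every [o] has a projection to a geodesic from [x] to [z] which is close to the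
    geodesics from [o] to [x] and to [z], by the Morse lemma in [rho]. Hence both
    products of [x] and [z] seen from [o], for [rho] and for the distance of [X],
    are comparable to the distance from [o] to this projection; and geodesic
    triangles of [X] are thin. *)
Lemma hyperbolic_of_rough_metric (rho : X -> X -> R) (delta L : R) :
  rough_hyperbolic rho delta -> 1 <= L ->
  (forall x y, rho x y <= L * mdist x y + L) ->
  (forall x y, mdist x y <= L * rho x y + L) ->
  hyperbolic_space X /\
  exists K : R, forall o x y,
    rough_product rho o x y <= K * gromov_product o x y + K.
Proof.
move=> rhoH L1 rho_le le_rho.
have L0 : 0 <= L by exact: le_trans L1.
have d0 : 0 <= delta by case: rhoH.
have rhoC x y : rho x y = rho y x by case: rhoH.
have [K K0 hK] := quasi_geodesic_product_bounded rhoH L1.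
have [C C0 hC] := quasi_geodesic_near rhoH L1.
have qg c x y : is_geodesic c x y -> quasi_geodesic rho L c (mdist x y).
  by case=> _ _ hc s t hs ht; rewrite -hc // in_itv.
have near c x y o (B : R) : is_geodesic c x y -> rough_product rho o x y <= B ->
    exists2 t, 0 <= t <= mdist x y & mdist o (c t) <= L * (B + C) + L.
  move=> hc hB; have [t ht h] := hC c _ o (qg _ _ _ hc) (mdist_ge0 _ _).
  exists t => //; apply: le_trans (le_rho _ _) _; rewrite lerD2r ler_wpM2l //.
  by apply: le_trans h _; rewrite lerD2r; case: hc => -> ->.
have morse c x y (t : R) : is_geodesic c x y -> 0 <= t <= mdist x y ->
    rough_product rho (c t) x y <= K.
  move=> hc /andP[t0 t1]; have := hK c _ 0 t (mdist x y) (qg _ _ _ hc).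
  by case: hc => -> -> _; apply.
set E := L * (2 * C + K + delta) + L.
have E0 : 0 <= E by rewrite addr_ge0 // mulr_ge0 //; lra.
have centre o x z c : is_geodesic c x z -> exists t, [/\ 0 <= t <= mdist x z,
    mdist o (c t) <= gromov_product o x z + 2 * E &
    rough_product rho o x z <= rho o (c t) + K + delta].
  move=> hc; have [t ht hoc] := hC c _ o (qg _ _ _ hc) (mdist_ge0 _ _).
  have hm := morse _ _ _ _ hc ht.
  exists t; split=> //; last first.
    have := rough_triangle rhoH (c t) x o; have := rough_triangle rhoH (c t) z o.
    by move: hm; rewrite /rough_product (rhoC (c t) o); lra.
  move: hoc; case: (hc) => -> -> _ hoc.
  have [hpx hpz] : rough_product rho (c t) o x <= C + K + delta /\
      rough_product rho (c t) o z <= C + K + delta.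
    have := rough_product_ge rhoH o x (c t).
    have := rough_product_ge rhoH o z (c t).
    move: hm hoc; rewrite /rough_product.
    by rewrite (rhoC o x) (rhoC o z); lra.
  have half y : rough_product rho (c t) o y <= C + K + delta ->
      mdist o (c t) + mdist (c t) y - 2 * E <= mdist y o.
    move=> hy; have [c' hc'] := X_geodesic o y.
    have [s hs h] := near c' o y (c t) _ hc' hy.
    have [h1 h2] := geodesic_split hc' hs.
    have := metric_triangle o (c' s) (c t); have := metric_triangle (c t) (c' s) y.
    have : mdist (c t) (c' s) <= E by apply: le_trans h _; rewrite /E; lra.
    by rewrite (metric_sym (c' s) (c t)) (metric_sym y o); lra.
  have := half _ hpx; have := half _ hpz; have := metric_triangle x (c t) z.
  by rewrite /gromov_product (metric_sym x (c t)); lra.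
split.
  set E' := L * (K + delta / 2 + C) + L.
  have E'0 : 0 <= E' by rewrite addr_ge0 // mulr_ge0 //; lra.
  exists (2 * E + E') => [|o x y z]; first lra.
  have [c hc] := X_geodesic x z.
  have [t [ht h1 _]] := centre o _ _ _ hc.
  suff side u v : rough_product rho (c t) u v <= K + delta / 2 ->
      gromov_product o u v <= gromov_product o x z + (2 * E + E').
    by rewrite lerBlDr ge_min; apply/orP;
      case: (rough_product_min rhoH y (morse _ _ _ _ hc ht)) => /side; [left|right].
  move=> huv; have [c' hc'] := X_geodesic u v.
  have [s hs h2] := near c' _ _ _ _ hc' huv.
  have := gromov_product_le_dist o hc' hs.
  have := metric_triangle o (c t) (c' s).
  by rewrite -/E' in h2 *; lra.
exists (L * (2 * E + 1) + L + K + delta) => o x y.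
have [c hc] := X_geodesic x y.
have [t [ht h1 h2]] := centre o _ _ _ hc.
have g0 : 0 <= gromov_product o x y.
  by have := metric_triangle x o y; rewrite /gromov_product (metric_sym y o); lra.
have h3 := rho_le o (c t).
have h4 : L * mdist o (c t) <= L * (gromov_product o x y + 2 * E).
  exact: ler_wpM2l.
have h5 : 0 <= (L * (2 * E) + L + K + delta) * gromov_product o x y.
  by rewrite mulr_ge0 // !addr_ge0 // mulr_ge0 //; lra.
by lra.
Qed.

(** Quasi-isometry invariance of hyperbolicity, in a form where the model
    [(T, rho)] need not be geodesic, or even a metric space: it suffices that
    [X] is. *)
Lemma hyperbolic_of_rough_model (T : Type) (rho : T -> T -> R) (f : T -> X)
    (delta L r : R) :
  rough_hyperbolic rho delta -> 0 <= L -> 0 <= r ->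
  (forall s t, mdist (f s) (f t) <= L * rho s t + L) ->
  (forall s t, mdist (f s) (f t) <= 1 + 2 * r -> rho s t <= L) ->
  (forall y, exists t, mdist (f t) y <= r) ->
  hyperbolic_space X /\
  exists K : R, forall o s t : T,
    rough_product rho o s t <= K * gromov_product (f o) (f s) (f t) + K.
Proof.
move=> rhoH L0 r0 le_rho rho_step /choice [sigma hsigma].
have d0 : 0 <= delta by case: rhoH.
have rhoC s t : rho s t = rho t s by case: rhoH.
pose rho' x y := rho (sigma x) (sigma y).
have rho'H : rough_hyperbolic rho' delta.
  by case: rhoH => ? ? ? ? ?; split=> // *; rewrite /rho'.
set L' := 2 * L + delta + 2 * r + 1.
have L'1 : 1 <= L' by rewrite /L'; lra.
have rho'_le x y : rho' x y <= L' * mdist x y + L'.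
  have [c hc] := X_geodesic x y; set D := mdist x y.
  have D0 : 0 <= D by exact: mdist_ge0.
  have [N [tt [ND tt0 ttN tt_in tt_step]]] := unit_subdivision D0.
  case: (hc) => c0 c1 hiso.
  have chain i : (i <= N)%N -> rho' x (c (tt i)) <= (L + delta) * i%:R.
    elim: i => [_|i IH iN].
      by rewrite tt0 c0 mulr0; case: rho'H => _ ->.
    have := rough_triangle rho'H (c (tt i)) x (c (tt i.+1)).
    have := IH (ltnW iN).
    have : rho' (c (tt i)) (c (tt i.+1)) <= L.
      apply: rho_step.
      have h : mdist (c (tt i)) (c (tt i.+1)) = `|tt i - tt i.+1|.
        by apply: hiso; rewrite in_itv /=; apply: tt_in => //; exact: ltnW.
      have := tt_step i; rewrite -h.
      have := hsigma (c (tt i)); have := hsigma (c (tt i.+1)).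
      have := metric_triangle (f (sigma (c (tt i)))) (c (tt i)) (f (sigma (c (tt i.+1)))).
      have := metric_triangle (c (tt i)) (c (tt i.+1)) (f (sigma (c (tt i.+1)))).
      by rewrite (metric_sym (c (tt i.+1)) (f _)); lra.
    by rewrite -natr1; lra.
  have := chain N (leqnn N); rewrite ttN c1 => h.
  apply: le_trans h _.
  have : (L + delta) * N%:R <= L' * (D + 1).
    by apply: ler_pM => //; rewrite /L'; lra.
  by lra.
have le_rho' x y : mdist x y <= L' * rho' x y + L'.
  have := le_rho (sigma x) (sigma y); rewrite -/(rho' x y).
  have := hsigma x; have := hsigma y.
  have := metric_triangle x (f (sigma x)) y.
  have := metric_triangle (f (sigma x)) (f (sigma y)) y.
  rewrite (metric_sym x (f _)).
  have : 0 <= (L + delta + 2 * r + 1) * rho' x y.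
    by rewrite mulr_ge0 //; [lra | case: rho'H].
  by rewrite /L'; lra.
have [X_hyp [K hK]] := hyperbolic_of_rough_metric rho'H L'1 rho'_le le_rho'.
split=> //; exists (`|K| + 3 * (L + delta)) => o s t.
have corr u : rho u (sigma (f u)) <= L.
  apply: rho_step; have := hsigma (f u); rewrite metric_sym; lra.
have near u v : `|rho u v - rho' (f u) (f v)| <= 2 * L + 2 * delta.
  have := rough_triangle rhoH (sigma (f u)) u v.
  have := rough_triangle rhoH (sigma (f v)) (sigma (f u)) v.
  have := rough_triangle rhoH u (sigma (f u)) (sigma (f v)).
  have := rough_triangle rhoH v u (sigma (f v)).
  have := corr u; have := corr v; rewrite -/(rho' (f u) (f v)).
  rewrite (rhoC (sigma (f v)) v) (rhoC (sigma (f u)) u) ler_norml.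
  by move=> *; apply/andP; split; lra.
have /ler_normlP [] := near s o; have /ler_normlP [] := near t o.
have /ler_normlP [] := near s t.
have := hK (f o) (f s) (f t); rewrite /rough_product.
set g := gromov_product _ _ _.
have g0 : 0 <= g.
  have := metric_triangle (f s) (f o) (f t).
  by rewrite /g /gromov_product (metric_sym (f t) (f o)); lra.
have : K * g <= `|K| * g by apply: ler_wpM2r => //; exact: ler_norm.
have := ler_norm K.
have : 0 <= (L + delta) * g by apply: mulr_ge0 => //; lra.
by lra.
Qed.

End QuasiIsometryInvariance.

(** * Boundary points and horokernels *)

Section Boundary.
Variables (R : realType) (X : metricType R).
Implicit Types (x y z o : X) (u v w : nat -> X) (xi eta : set (nat -> X)).

Definition hyperbolic_with (delta : R) : Prop :=
  0 <= delta /\ forall o x y z,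
    Num.min (gromov_product o x y) (gromov_product o y z) - delta
    <= gromov_product o x z.

Lemma gromov_product_min (delta : R) o x y z (B : R) : hyperbolic_with delta ->
  gromov_product o x z < B - delta ->
  gromov_product o x y < B \/ gromov_product o y z < B.
Proof.
move=> [_ /(_ o x y z)]; rewrite /Num.min; case: ifP => _; lra.
Qed.

Lemma gromov_product_ge_trans (delta : R) o x y z (B : R) :
  hyperbolic_with delta -> B <= gromov_product o x y ->
  B <= gromov_product o y z -> B - delta <= gromov_product o x z.
Proof.
move=> hyp h1 h2; rewrite leNgt; apply/negP.
by move=> /(gromov_product_min y hyp); lra.
Qed.

Lemma gromov_equiv_sym u v : gromov_equiv u v -> gromov_equiv v u.
Proof.
move=> h o M; have [N hN] := h o M; exists N => m n hm hn.
by rewrite gromov_productC; exact: hN.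
Qed.

Lemma gromov_equiv_trans (delta : R) v u w : hyperbolic_with delta ->
  gromov_equiv u v -> gromov_equiv v w -> gromov_equiv u w.
Proof.
move=> hyp huv hvw o M.
have [N1 h1] := huv o (M + delta); have [N2 h2] := hvw o (M + delta).
exists (maxn N1 N2) => m n; rewrite !geq_max => /andP[? ?] /andP[? ?].
have := @gromov_product_ge_trans delta o (u m) (v (maxn N1 N2)) (w n) (M + delta).
rewrite addrK; apply=> //; first by apply: h1 => //; exact: leq_maxl.
by apply: h2 => //; exact: leq_maxr.
Qed.

Lemma gromov_equiv_near (C : R) u v : gromov_sequence u ->
  (exists N : nat, forall n, (N <= n)%N -> mdist (u n) (v n) <= C) ->
  gromov_equiv u v.
Proof.
move=> hu [N hN] o M; have [N' h] := hu o (M + C).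
exists (maxn N N') => m n; rewrite !geq_max => /andP[? ?] /andP[Nn ?].
have hmn : M + C <= gromov_product o (u m) (u n) by exact: h.
have := hN n Nn; have := metric_triangle (u n) (v n) o.
have := metric_triangle (u m) (u n) (v n).
by move: hmn; rewrite /gromov_product; lra.
Qed.

Lemma boundary_equiv (delta : R) xi u v : hyperbolic_with delta ->
  gromov_boundary xi -> xi u -> xi v -> gromov_equiv u v.
Proof.
move=> hyp [w hw <-] [_ h1] [_ h2].
by apply: gromov_equiv_trans hyp _ h2; exact: gromov_equiv_sym.
Qed.

Lemma boundary_mem (delta : R) xi u v : hyperbolic_with delta ->
  gromov_boundary xi -> xi u -> gromov_equiv u v -> xi v.
Proof.
move=> hyp [w hw <-] [_ h1] h2; split; last exact: gromov_equiv_trans hyp h1 h2.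
by apply: (gromov_equiv_trans hyp _ h2); exact: gromov_equiv_sym.
Qed.

Lemma boundary_eq (delta : R) xi eta u v : hyperbolic_with delta ->
  gromov_boundary xi -> gromov_boundary eta -> xi u -> eta v ->
  gromov_equiv u v -> xi = eta.
Proof.
move=> hyp hxi heta xu ev uv; apply/seteqP; split=> w hw.
- apply: (boundary_mem hyp heta ev); apply: (gromov_equiv_trans hyp _ _).
    exact/gromov_equiv_sym/uv.
  exact: (boundary_equiv hyp hxi).
- apply: (boundary_mem hyp hxi xu); apply: (gromov_equiv_trans hyp uv _).
  exact: (boundary_equiv hyp heta).
Qed.

Lemma boundary_nonempty xi : gromov_boundary xi -> exists2 u, xi u & gromov_sequence u.
Proof. by move=> [u hu <-]; exists u. Qed.

Lemma boundary_sequence xi u : gromov_boundary xi -> xi u -> gromov_sequence u.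
Proof. by move=> [w hw <-] []. Qed.

(** By the Tychonoff theorem, since the values of horofunctions at [(x, y)] are
    bounded by the distance from [x] to [y]. *)
Lemma horokernel_exists xi : gromov_boundary xi -> exists k, horokernel xi k.
Proof.
move=> /boundary_nonempty[u xu _].
pose A (p : X * X) : set R := `[- mdist p.1 p.2, mdist p.1 p.2]%classic.
have cA := @tychonoff (X * X)%type (fun=> R) A (fun p => @segment_compact R _ _).
have hA : (horofunctions u @ \oo) [set f | forall p, A p (f p)].
  exists 0%N => // n _ /= p.
  rewrite /A /horofunctions /= in_itv /=.
  have := metric_triangle p.1 p.2 (u n); have := metric_triangle p.2 p.1 (u n).
  by rewrite (metric_sym p.2 p.1) => ? ?; apply/andP; split; lra.
have [k [_ hk]] := cA (horofunctions u @ \oo) _ hA.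
by exists k, u.
Qed.

Lemma horokernel_approx xi k : horokernel xi k -> exists2 u, xi u &
  forall (p q s : X * X) (e : R) (N : nat), 0 < e -> exists n, [/\ (N <= n)%N,
    `|horofunctions u n p - k p| < e, `|horofunctions u n q - k q| < e &
    `|horofunctions u n s - k s| < e].
Proof.
move=> [u xu hk]; exists u => // p q s e N e0.
have near r : nbhs k [set f : {ptws (X * X) -> R} | `|f r - k r| < e].
  have := @proj_continuous _ (fun=> R) r k.
  move=> /(_ [set y | `|y - k r| < e]); apply.
  have := @nbhsx_ballx R R (k r) e e0; apply: filterS => y.
  by rewrite /ball /= distrC.
have hN : (horofunctions u @ \oo)
    [set f | exists2 n, (N <= n)%N & f = horofunctions u n].
  by exists N => // n /= Nn; exists n.
have [f [[n Nn ->]]] := hk _ _ hN (filterI (near p) (filterI (near q) (near s))).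
by move=> [hp [hq hs]]; exists n.
Qed.

End Boundary.

Section Horokernels.
Variables (R : realType) (X : metricType R).
Implicit Types (x y z o : X) (u v w : nat -> X) (xi eta : set (nat -> X)).
Implicit Types (k : {ptws (X * X) -> R}).

Lemma le_of_eps (a b c : R) : 0 <= c ->
  (forall e, 0 < e -> a <= b + c * e) -> a <= b.
Proof.
move=> c0 h; apply/ler_addgt0Pl => e e0.
have c1 : 0 < c + 1 by lra.
have := h (e / (c + 1)) (divr_gt0 e0 c1).
have e1 : 0 <= e / (c + 1) by rewrite ltW // divr_gt0.
have -> : c * (e / (c + 1)) = e - e / (c + 1) by field; rewrite gt_eqF.
by lra.
Qed.

Lemma horokernel_cocycle xi k x y z : horokernel xi k ->
  k (x, y) + k (y, z) = k (x, z).
Proof.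
move=> /horokernel_approx[u _ hu].
have h e : 0 < e -> `|k (x, y) + k (y, z) - k (x, z)| <= 0 + 3 * e.
  move=> e0; have [n [_]] := hu (x, y) (y, z) (x, z) e 0%N e0.
  rewrite /horofunctions /= => /ltr_normlP[? ?] /ltr_normlP[? ?] /ltr_normlP[? ?].
  by apply/ler_normlP; split; lra.
have /ler_normlP[? ?] : `|k (x, y) + k (y, z) - k (x, z)| <= 0.
  by apply: le_of_eps h.
by lra.
Qed.

Lemma horokernelxx xi k x : horokernel xi k -> k (x, x) = 0.
Proof. by move=> /(horokernel_cocycle x x x); lra. Qed.

Lemma horokernel_le_dist xi k x y : horokernel xi k -> `|k (x, y)| <= mdist x y.
Proof.
move=> /horokernel_approx[u _ hu].
apply: (@le_of_eps _ _ 1) => // e e0.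
have [n [_ + _ _]] := hu (x, y) (x, y) (x, y) e 0%N e0.
rewrite /horofunctions /= => /ltr_normlP[? ?].
have := metric_triangle x y (u n); have := metric_triangle y x (u n).
by rewrite (metric_sym y x) => ? ?; apply/ler_normlP; split; lra.
Qed.

(** Twice the level at which the geodesics from [y] and [z] to the boundary point
    merge; levels are counted from [o], and increase towards this point. *)
Definition merging k o y z : R := k (o, y) + k (o, z) + mdist y z.

Lemma mergeC k o y z : merging k o y z = merging k o z y.
Proof. by rewrite /merging (metric_sym y z); lra. Qed.

Section Hyperbolic.
Variable delta : R.
Hypothesis hyp : hyperbolic_with X delta.

Lemma four_point x y z o :
  mdist x z + mdist y o <= mdist x y + mdist z o + 2 * delta \/
  mdist x z + mdist y o <= mdist y z + mdist x o + 2 * delta.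
Proof.
case: hyp => _ /(_ o x y z); rewrite /gromov_product /Num.min.
by case: ifP => _ ?; [left|right]; lra.
Qed.

(** As the Gromov product of [u m] and [v n] seen from [x] is large, only one
    alternative of the four-point condition is left. *)
Lemma horofunctions_close xi u v x y : gromov_boundary xi -> xi u -> xi v ->
  exists N : nat, forall m n, (N <= m)%N -> (N <= n)%N ->
    horofunctions u m (x, y) - horofunctions v n (x, y) <= 2 * delta.
Proof.
move=> hxi xu xv; have uv := boundary_equiv hyp hxi xu xv.
have [N hN] := uv x (mdist x y + delta + 1).
exists N => m n hm hn; have := hN m n hm hn.
have d0 : 0 <= delta by case: hyp.
rewrite /horofunctions /gromov_product /=.
have := metric_triangle x y (v n).
rewrite (metric_sym (u m) x) (metric_sym (v n) x).
have := four_point x y (u m) (v n).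
by rewrite (metric_sym y (u m)); case; lra.
Qed.

Lemma horokernel_close xi k k' x y : gromov_boundary xi ->
  horokernel xi k -> horokernel xi k' -> k (x, y) <= k' (x, y) + 2 * delta.
Proof.
move=> hxi /horokernel_approx[u xu hu] /horokernel_approx[v xv hv].
have [N hN] := horofunctions_close x y hxi xu xv.
apply: (@le_of_eps _ _ 2) => // e e0.
have [m [hm /ltr_normlP[q1 q2] _ _]] := hu (x, y) (x, y) (x, y) e N e0.
have [n [hn /ltr_normlP[q3 q4] _ _]] := hv (x, y) (x, y) (x, y) e N e0.
by have := hN m n hm hn; lra.
Qed.

(** The inequality between Gromov products seen from a point that tends to the
    boundary point. *)
Lemma merge_ultrametric xi k o x y z : horokernel xi k ->
  merging k o x z <= merging k o x y + 2 * delta \/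
  merging k o x z <= merging k o y z + 2 * delta.
Proof.
move=> /horokernel_approx[u xu hu].
have [h1|h1] := leP (merging k o x z) (merging k o x y + 2 * delta); first by left.
right; apply: contrapT => /negP; rewrite -ltNge => h2.
pose e := Num.min (merging k o x z - (merging k o x y + 2 * delta))
                  (merging k o x z - (merging k o y z + 2 * delta)) / 4.
have e0 : 0 < e by rewrite divr_gt0 // lt_min; lra.
have [e1 e2] : e <= (merging k o x z - (merging k o x y + 2 * delta)) / 4 /\
    e <= (merging k o x z - (merging k o y z + 2 * delta)) / 4.
  by split; rewrite ler_pM2r ?invr_gt0 // ge_min lexx ?orbT.
have [n [_ /ltr_normlP[q1 q2] /ltr_normlP[q3 q4] /ltr_normlP[q5 q6]]] :=
  hu (o, x) (o, y) (o, z) e 0%N e0.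
move: e1 e2 h1 h2; rewrite /merging /horofunctions /= in q1 q2 q3 q4 q5 q6 *.
move=> ? ? ? ?.
case: hyp => _ /(_ (u n) x y z); rewrite /gromov_product /Num.min.
by case: ifP => _ ?; lra.
Qed.

Lemma merge_chain xi k o x y z (B : R) : horokernel xi k ->
  merging k o x y <= B -> merging k o y z <= B -> merging k o x z <= B + 2 * delta.
Proof. by move=> hk h1 h2; case: (merge_ultrametric o x y z hk); lra. Qed.

(** The point is taken on a geodesic from [o] to some [u N], at a distance at which
    this geodesic is still common to the geodesics from [o] to all later [u n]. *)
Lemma horokernel_unbounded xi k o (M : R) : geodesic_space X ->
  gromov_boundary xi -> horokernel xi k -> exists y, M <= k (o, y).
Proof.
move=> X_geo hxi /horokernel_approx[u xu hu].
have d0 : 0 <= delta by case: hyp.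
pose M' := `|M| + 2 * delta + 1.
have MM := ler_norm M; have M0 : 0 <= `|M| by [].
have [N hN] := boundary_sequence hxi xu o M'.
have [c hc] := X_geo o (u N).
have hM : 0 <= M' <= mdist o (u N).
  have := hN N N (leqnn N) (leqnn N).
  rewrite /gromov_product mdistxx (metric_sym (u N)) /M' => ?.
  by apply/andP; split; lra.
have [h1 h2] := geodesic_split hc hM.
exists (c M').
have [n [hn /ltr_normlP[q1 q2] _ _]] := hu (o, c M') (o, c M') (o, c M') 1 N ltr01.
have h3 : M' <= gromov_product o (c M') (u N).
  by rewrite /gromov_product h2 (metric_sym _ o) h1 (metric_sym _ o); lra.
have := gromov_product_ge_trans hyp h3 (hN N n (leqnn N) hn).
rewrite /gromov_product (metric_sym _ o) h1 (metric_sym _ o).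
have M'E : M' = `|M| + 2 * delta + 1 by [].
by rewrite /horofunctions /= in q1 q2; lra.
Qed.

(** Up to a bounded error, [k (o, y)] plus the distance from [o] to [y] is twice
    the Gromov product, seen from [o], of [y] and the base point of [k]: so it
    tends to infinity along the sequences that tend to this point, and stays
    bounded along those that tend to another one. *)
Lemma horokernel_converging xi k v o (M : R) : gromov_boundary xi ->
  horokernel xi k -> xi v ->
  exists N : nat, forall n, (N <= n)%N -> M <= k (o, v n) + mdist o (v n).
Proof.
move=> hxi /horokernel_approx[u xu hu] xv.
have [N hN] := boundary_equiv hyp hxi xu xv o (`|M| + 1).
have MM := ler_norm M; have M0 : 0 <= `|M| by [].
exists N => n hn.
have [m [hm /ltr_normlP[q1 q2] _ _]] := hu (o, v n) (o, v n) (o, v n) 1 N ltr01.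
have := hN m n hm hn; rewrite /gromov_product /horofunctions /= in q1 q2 *.
by rewrite (metric_sym (v n) o) (metric_sym (u m) o) (metric_sym (u m)); lra.
Qed.

(** The bound is uniform over the sequences, which serves for the translates of
    one of them by infinitely many isometries. *)
Lemma horokernel_diverging xi eta k o : gromov_boundary xi ->
  gromov_boundary eta -> xi <> eta -> horokernel xi k ->
  exists M : R, forall w, eta w -> exists N : nat, forall n, (N <= n)%N ->
    k (o, w n) + mdist o (w n) <= M.
Proof.
move=> hxi heta xieta hk; have [u xu hu] := horokernel_approx hk.
have [v ev _] := boundary_nonempty heta.
have d0 : 0 <= delta by case: hyp.
have : ~ gromov_equiv u v.
  by move=> uv; apply: xieta; exact: (boundary_eq hyp _ _ xu ev uv).
move=> /existsNP[p] /existsNP[M1 hM1].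
exists (2 * (M1 + 3 * delta) + 2 * mdist o p + 2) => w ew.
have [N1 h1] := boundary_equiv hyp hxi xu xu p (M1 + 3 * delta).
have [N2 h2] := boundary_equiv hyp heta ew ev p (M1 + 3 * delta).
pose N := maxn N1 N2; exists N => n hn.
have {hM1}[m0 [n0 [hm0 hn0 hlt]]] : exists m0 n0, [/\ (N <= m0)%N, (N <= n0)%N &
    gromov_product p (u m0) (v n0) < M1].
  apply: contrapT => hno; apply: hM1; exists N => m0 n0 hm0 hn0.
  by rewrite leNgt; apply/negP => hlt; apply: hno; exists m0, n0.
have [m [hm /ltr_normlP[q1 q2] _ _]] := hu (p, w n) (p, w n) (p, w n) 1 N ltr01.
have [N1N N2N] : (N1 <= N)%N /\ (N2 <= N)%N by rewrite leq_maxl leq_maxr.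
have hum := h1 m0 m (leq_trans N1N hm0) (leq_trans N1N hm).
have hwn := h2 n n0 (leq_trans N2N hn) (leq_trans N2N hn0).
have hmw : gromov_product p (u m) (w n) < M1 + 2 * delta.
  rewrite ltNge; apply/negP => h.
  have h3 : M1 + 2 * delta <= gromov_product p (u m0) (u m) by lra.
  have h4 := gromov_product_ge_trans hyp h3 h.
  have h5 : M1 + delta <= gromov_product p (w n) (v n0) by lra.
  have h6 : M1 + delta <= gromov_product p (u m0) (w n) by lra.
  by have := gromov_product_ge_trans hyp h6 h5; lra.
have hc := horokernel_cocycle o p (w n) hk.
have hko := horokernel_le_dist o p hk; have hkp := ler_norm (k (o, p)).
have := metric_triangle o p (w n).
move: hmw; rewrite /gromov_product /horofunctions /= in q1 q2 *.
by rewrite (metric_sym (w n) p) (metric_sym (u m) p) (metric_sym (u m)); lra.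
Qed.

End Hyperbolic.
End Horokernels.

(** * Isometries fixing a boundary point *)

Section IsometricActions.
Variables (R : realType) (X : metricType R) (Gam : groupType).
Variable act : Gam -> X -> X.
Hypothesis act_isom : isometric_action act.
Implicit Types (g h s : Gam) (x y z o : X) (u v : nat -> X).
Implicit Types (xi eta : set (nat -> X)) (k : {ptws (X * X) -> R}).

Lemma act1 x : act 1%g x = x. Proof. by case: act_isom. Qed.
Lemma actM g h x : act (g * h)%g x = act g (act h x).
Proof. by case: act_isom. Qed.
Lemma act_dist g x y : mdist (act g x) (act g y) = mdist x y.
Proof. by case: act_isom. Qed.
Lemma actVK g x : act g^-1%g (act g x) = x. Proof. by rewrite -actM mulVg act1. Qed.
Lemma actKV g x : act g (act g^-1%g x) = x. Proof. by rewrite -actM mulgV act1. Qed.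

Lemma act_distl g x y : mdist (act g x) y = mdist x (act g^-1%g y).
Proof. by rewrite -(act_dist g x) actKV. Qed.

Lemma act_conj_dist g h x :
  mdist x (act (g^-1 * h * g)%g x) = mdist (act g x) (act (h * g)%g x).
Proof. by rewrite -(act_dist g x) -actM !mulgA mulgV mul1g. Qed.

Lemma iter_act g n x : iter n (act g) x = act (g ^+ n)%g x.
Proof. by elim: n => [|n IH]; rewrite ?act1 // iterS IH -actM expgS. Qed.

Lemma orbit_dist_mul x g h :
  mdist x (act (g * h)%g x) <= mdist x (act g x) + mdist x (act h x).
Proof.
by rewrite actM -(act_dist g x (act h x)); exact: metric_triangle.
Qed.

Lemma orbit_distV x g : mdist x (act g^-1%g x) = mdist x (act g x).
Proof. by rewrite metric_sym act_distl invgK. Qed.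

Lemma orbit_dist_exp x g (n : nat) :
  mdist x (act (g ^+ n)%g x) <= n%:R * mdist x (act g x).
Proof.
elim: n => [|n IH]; first by rewrite act1 mdistxx mul0r.
by rewrite expgS -natr1; have := orbit_dist_mul x g (g ^+ n)%g; lra.
Qed.

Lemma orbit_dist_expz x g (n : int) :
  mdist x (act (expgz g n) x) <= `|n%:~R| * mdist x (act g x).
Proof.
case: n => n /=; first by rewrite normr_nat; exact: orbit_dist_exp.
by rewrite orbit_distV NegzE mulrNz normrN normr_nat; exact: orbit_dist_exp.
Qed.

Lemma gromov_product_act g o x y :
  gromov_product o (act g x) (act g y) = gromov_product (act g^-1%g o) x y.
Proof. by rewrite /gromov_product !act_dist !act_distl. Qed.

Lemma gromov_equiv_act g u v :
  gromov_equiv u v -> gromov_equiv (act g \o u) (act g \o v).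
Proof.
move=> h o M; have [N hN] := h (act g^-1%g o) M; exists N => m n hm hn /=.
by rewrite gromov_product_act; exact: hN.
Qed.

Lemma comp_actM g h u : act (g * h)%g \o u = act g \o (act h \o u).
Proof. by apply/funext => n /=; rewrite actM. Qed.

Lemma comp_actVK g u : act g^-1%g \o (act g \o u) = u.
Proof. by apply/funext => n /=; rewrite actVK. Qed.

Lemma comp_actKV g u : act g \o (act g^-1%g \o u) = u.
Proof. by apply/funext => n /=; rewrite actKV. Qed.

Definition translate g xi : set (nat -> X) := [set act g \o u | u in xi].

Lemma translateM g h xi : translate (g * h)%g xi = translate g (translate h xi).
Proof.
apply/seteqP; split=> [_ [u xu <-]|_ [_ [u xu <-] <-]].
- by rewrite comp_actM; exists (act h \o u) => //; exists u.
- by rewrite -comp_actM; exists u.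
Qed.

Lemma translate1 xi : translate 1%g xi = xi.
Proof.
have E u : act 1%g \o u = u by apply/funext => n /=; rewrite act1.
by apply/seteqP; split=> [_ [u xu <-]|u xu]; [rewrite E | exists u].
Qed.

Lemma translate_boundary g xi : gromov_boundary xi -> gromov_boundary (translate g xi).
Proof.
move=> [u hu <-]; exists (act g \o u); first exact: gromov_equiv_act.
apply/seteqP; split=> [v [hv uv]|_ [v [hv uv] <-]].
- exists (act g^-1%g \o v); last exact: comp_actKV.
  by split; [|rewrite -(comp_actVK g u)]; exact: gromov_equiv_act.
- by split; exact: gromov_equiv_act.
Qed.

Lemma fixesM g h xi : fixes_boundary_point act g xi ->
  fixes_boundary_point act h xi -> fixes_boundary_point act (g * h)%g xi.
Proof.
rewrite /fixes_boundary_point -!/(translate _ _) translateM => + ->.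
by [].
Qed.

Lemma fixesX g n xi : fixes_boundary_point act g xi ->
  fixes_boundary_point act (g ^+ n)%g xi.
Proof.
move=> hg; elim: n => [|n IH]; first exact: translate1.
by rewrite expgS; exact: fixesM.
Qed.

Section Hyperbolic.
Variable delta : R.
Hypothesis hyp : hyperbolic_with X delta.

Let delta_ge0 : 0 <= delta. Proof. by case: hyp. Qed.

Lemma fixes_of_equiv g xi u : gromov_boundary xi -> xi u ->
  gromov_equiv u (act g \o u) -> fixes_boundary_point act g xi.
Proof.
move=> hxi xu h; apply/esym.
apply: (boundary_eq hyp hxi (translate_boundary g hxi) xu _ h).
by exists u.
Qed.

(** [g^-1] maps sequences that tend to [xi] to such sequences, and these have close
    horofunctions. *)
Lemma horokernel_quasi_invariant xi k g x y : gromov_boundary xi ->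
  horokernel xi k -> fixes_boundary_point act g xi ->
  `|k (act g x, act g y) - k (x, y)| <= 2 * delta.
Proof.
move=> hxi /horokernel_approx[u xu hu] hg.
have [v xv uE] : translate g xi u by rewrite /translate hg.
have [N hN] := horofunctions_close hyp x y hxi xu xv.
have [N' hN'] := horofunctions_close hyp x y hxi xv xu.
have h e : 0 < e -> `|k (act g x, act g y) - k (x, y)| <= 2 * delta + 2 * e.
  move=> e0.
  have [m [hm /ltr_normlP[q1 q2] _ _]] :=
    hu (act g x, act g y) (x, y) (x, y) e (maxn N N') e0.
  have [n [hn /ltr_normlP[q3 q4] _ _]] := hu (x, y) (x, y) (x, y) e (maxn N N') e0.
  move: hm hn; rewrite !geq_max => /andP[Nm N'm] /andP[Nn N'n].
  have := hN n m Nn Nm; have := hN' m n N'm N'n.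
  have E : horofunctions u m (act g x, act g y) = horofunctions v m (x, y).
    by rewrite -uE /horofunctions /= !act_dist.
  by rewrite E in q1 q2 => ? ?; apply/ler_normlP; split; lra.
by apply: le_of_eps h.
Qed.

Lemma horokernel_act_quasi xi k g o y : gromov_boundary xi ->
  horokernel xi k -> fixes_boundary_point act g xi ->
  `|k (o, act g y) - k (o, act g o) - k (o, y)| <= 2 * delta.
Proof.
move=> hxi hk hg; have := horokernel_quasi_invariant o y hxi hk hg.
rewrite -(horokernel_cocycle o (act g o) (act g y) hk).
by rewrite [_ + k (act g o, _)]addrC addrK.
Qed.

Lemma merge_act xi k g o y z (c : R) : gromov_boundary xi ->
  horokernel xi k -> fixes_boundary_point act g xi -> `|k (o, act g o)| <= c ->
  merging k o (act g y) (act g z) <= merging k o y z + 2 * c + 4 * delta.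
Proof.
move=> hxi hk hg /ler_normlP[_ hc]; rewrite /merging act_dist.
have /ler_normlP[_ h1] := horokernel_act_quasi o y hxi hk hg.
have /ler_normlP[_ h2] := horokernel_act_quasi o z hxi hk hg.
by lra.
Qed.

(** Elements that fix two boundary points and do not move the horospheres at one
    of them displace [o] by a bounded amount: they coarsely fix the geodesic
    between these points. *)
Lemma displacement_bounded_of_fixes2 xi eta k o (c : R) : gromov_boundary xi ->
  gromov_boundary eta -> xi <> eta -> horokernel xi k ->
  exists K : R, forall g, fixes_boundary_point act g xi ->
    fixes_boundary_point act g eta -> `|k (o, act g o)| <= c ->
    mdist o (act g o) <= K.
Proof.
move=> hxi heta xieta hk; have d0 := delta_ge0.
have [M hM] := horokernel_diverging hyp o hxi heta xieta hk.
have [v ev _] := boundary_nonempty heta.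
exists (`|M| + 3 * c + 8 * delta) => g gxi geta hc.
have egv : eta (act g \o v) by rewrite -geta; exists v.
have [N1 h1] := hM v ev; have [N2 h2] := hM _ egv.
have [N3 h3] := boundary_equiv hyp heta ev egv o `|M|.
pose n := maxn N1 (maxn N2 N3).
have n1 : (N1 <= n)%N by exact: leq_maxl.
have n2 : (N2 <= n)%N by rewrite /n !leq_max leqnn orbT.
have n3 : (N3 <= n)%N by rewrite /n !leq_max leqnn !orbT.
have := h1 n n1; have := h2 n n2; have := h3 n n n3 n3 => /= q3 q2 q1.
have MM := ler_norm M; have M0 : 0 <= `|M| by [].
have c0 : 0 <= c by apply: le_trans hc.
set B := `|M| + 2 * c + 4 * delta.
have m1 : merging k o o (v n) <= B.
  by rewrite /merging (horokernelxx o hk) /B; lra.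
have m2 : merging k o (v n) (act g (v n)) <= B.
  move: q3; rewrite /merging /gromov_product /B.
  by rewrite (metric_sym _ o) (metric_sym (act g (v n)) o); lra.
have m3 : merging k o (act g (v n)) (act g o) <= B.
  apply: le_trans (merge_act (v n) o hxi hk gxi hc) _.
  by rewrite mergeC /merging (horokernelxx o hk) /B; lra.
have m12 := merge_chain hyp hk m1 m2.
have m3' : merging k o (act g (v n)) (act g o) <= B + 2 * delta by lra.
have := merge_chain hyp hk m12 m3'.
rewrite {1}/merging (horokernelxx o hk) /B; case/ler_normlP: hc; lra.
Qed.

(** Each step along the orbit costs [2 * delta] in the ultrametric inequality; the
    gain of [tau] in level, counted twice, makes up for it when [delta <= tau].
    So the orbit of [o] follows a geodesic towards the boundary point. *)
Lemma merge_orbit xi k s o (tau D : R) : horokernel xi k ->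
  delta <= tau -> (forall n, `|k (o, act (s ^+ n)%g o) - n%:R * tau| <= D) ->
  exists2 C : R, 0 <= C & forall n,
    merging k o o (act (s ^+ n)%g o) <= 2 * n%:R * tau + C.
Proof.
move=> hk dtau hD; have d0 := delta_ge0.
have D0 : 0 <= D by apply: le_trans (hD 0%N).
have s0 : 0 <= mdist o (act s o) by exact: mdist_ge0.
exists (2 * D + mdist o (act s o) + 2 * delta) => [|n]; first by lra.
have step j : merging k o (act (s ^+ j)%g o) (act (s ^+ j.+1)%g o)
    <= 2 * j.+1%:R * tau + 2 * D + mdist o (act s o).
  rewrite /merging expgSr actM act_dist -actM -expgSr.
  have /ler_normlP[_ q1] := hD j; have /ler_normlP[_ q2] := hD j.+1.
  by move: q2; rewrite -!natr1; lra.
elim: n => [|n IH].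
  by rewrite /merging expg0 act1 (horokernelxx o hk) mdistxx; lra.
have := step n; move: IH; rewrite -!natr1 => q1 q2.
by case: (merge_ultrametric hyp o o (act (s ^+ n)%g o) (act (s ^+ n.+1)%g o) hk); lra.
Qed.

Lemma orbit_dist_linear xi k s o (tau D : R) : horokernel xi k ->
  delta <= tau -> (forall n, `|k (o, act (s ^+ n)%g o) - n%:R * tau| <= D) ->
  exists C : R, forall n, `|mdist o (act (s ^+ n)%g o) - n%:R * tau| <= C.
Proof.
move=> hk dtau hD; have [C C0 hC] := merge_orbit hk dtau hD.
exists (C + D) => n; have := hC n; rewrite /merging (horokernelxx o hk).
have /ler_normlP[q1 q2] := hD n.
have := horokernel_le_dist o (act (s ^+ n)%g o) hk => /ler_normlP[_ q3] q4.
by apply/ler_normlP; split; lra.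
Qed.

(** The contraction behind confining automorphisms: [s] pushes towards [xi] and
    [g] roughly preserves the horospheres, so that [s ^+ n o] and
    [g (s ^+ n o)] are at the same level, beyond the point where the geodesics
    from [o] and [g o] to [xi] merge. *)
Lemma conj_contraction xi k s o (tau D c : R) : gromov_boundary xi -> horokernel xi k ->
  delta <= tau -> (forall n, `|k (o, act (s ^+ n)%g o) - n%:R * tau| <= D) ->
  exists K : R, forall g n, fixes_boundary_point act g xi ->
    `|k (o, act g o)| <= c -> mdist o (act g o) <= 2 * n%:R * tau ->
    mdist o (act (s ^- n * g * s ^+ n)%g o) <= K.
Proof.
move=> hxi hk dtau hD; have [C C0 hC] := merge_orbit hk dtau hD.
have d0 := delta_ge0; exists (C + 2 * D + 3 * c + 10 * delta) => g n hg hc hn.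
have c0 : 0 <= c by apply: le_trans hc.
rewrite act_conj_dist actM; set y := act (s ^+ n)%g o.
set B := 2 * n%:R * tau + C + 2 * c + 4 * delta.
have m1 : merging k o y o <= B.
  by rewrite mergeC; apply: le_trans (hC n) _; rewrite /B; lra.
have m2 : merging k o o (act g o) <= B.
  by rewrite /merging (horokernelxx o hk) /B; case/ler_normlP: hc; lra.
have m3 : merging k o (act g o) (act g y) <= B.
  apply: le_trans (merge_act o y hxi hk hg hc) _.
  by have := hC n; rewrite -/y /B; lra.
have m12 := merge_chain hyp hk m1 m2.
have m3' : merging k o (act g o) (act g y) <= B + 2 * delta by lra.
have := merge_chain hyp hk m12 m3'; rewrite {1}/merging /B.
have /ler_normlP[q1 q2] := hD n; rewrite -/y in q1 q2.
have /ler_normlP[q3 q4] := horokernel_act_quasi o y hxi hk hg.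
case/ler_normlP: hc; lra.
Qed.

Section FixedPoint.
Variable xi : set (nat -> X).
Hypothesis xi_boundary : gromov_boundary xi.
Hypothesis xi_fixed : forall g, fixes_boundary_point act g xi.

Lemma horokernel_quasimorphism k o : horokernel xi k ->
  quasimorphism (fun g => k (o, act g o)) (2 * delta).
Proof.
by move=> hk g h; rewrite actM -addrA -opprD [_ + k (o, act h o)]addrC opprD addrA
  addrAC; exact: (horokernel_act_quasi o (act h o) xi_boundary hk).
Qed.

(** The homogenization for one horokernel and one [o]; the others differ from them
    by a bounded amount, which disappears in the average. *)
Lemma busemann_exists : exists beta, busemann act xi beta.
Proof.
have [k hk] := horokernel_exists xi_boundary.
have [u _ _] := boundary_nonempty xi_boundary; pose o := u 0%N.
have [beta hbeta] := homogenization (horokernel_quasimorphism o hk).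
exists beta => g _ k' hk' x.
apply: (@cvg_average _ _ _ (2 * delta + 2 * delta + 2 * mdist o x)) => n.
have /ler_normlP[q1 q2] := hbeta g n.
have := horokernel_close hyp x (act (g ^+ n)%g x) xi_boundary hk hk'.
have := horokernel_close hyp x (act (g ^+ n)%g x) xi_boundary hk' hk.
have := horokernel_cocycle o x (act (g ^+ n)%g x) hk.
have := horokernel_cocycle o (act (g ^+ n)%g o) (act (g ^+ n)%g x) hk.
have := horokernel_le_dist (act (g ^+ n)%g o) (act (g ^+ n)%g x) hk.
have := horokernel_le_dist o x hk; rewrite act_dist.
move=> /ler_normlP[? ?] /ler_normlP[? ?] ? ? ? ?.
by apply/ler_normlP; split; lra.
Qed.

Lemma busemann_close beta k o g n : busemann act xi beta -> horokernel xi k ->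
  `|k (o, act (g ^+ n)%g o) - n%:R * beta g| <= 2 * delta.
Proof.
move=> hb hk; have [beta' hbeta'] := homogenization (horokernel_quasimorphism o hk).
suff -> : beta g = beta' g by [].
have h1 := hb g (xi_fixed g) k hk o.
have h2 := cvg_average (hbeta' g).
exact: (cvg_unique _ h1 h2).
Qed.

Lemma busemann_hom beta k o (C : R) : busemann act xi beta -> horokernel xi k ->
  (forall c, derived c -> `|k (o, act c o)| <= C) ->
  forall g h, beta (g * h)%g = beta g + beta h.
Proof.
move=> hb hk hC.
apply: (homogenization_hom (horokernel_quasimorphism o hk) _ hC).
by move=> g n; exact: busemann_close.
Qed.

End FixedPoint.
End Hyperbolic.
End IsometricActions.

(** * Words and quasi-isometries *)

Section Words.
Variables (R : realType) (Gam : groupType).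
Implicit Types (S A : set Gam) (g h alpha : Gam) (m n : nat).

Definition has_word S n g : Prop := exists w : seq Gam,
  [/\ forall s, s \in w -> S s, (\big[*%g/1%g]_(s <- w) s) = g & (size w <= n)%N].

Lemma has_word_mono S m n g : (m <= n)%N -> has_word S m g -> has_word S n g.
Proof. by move=> mn [w [h1 h2 h3]]; exists w; split=> //; exact: leq_trans mn. Qed.

Lemma has_word1 S : has_word S 0 1%g.
Proof. by exists [::]; split=> //; rewrite big_nil. Qed.

Lemma has_word_gen S g : S g -> has_word S 1 g.
Proof.
move=> Sg; exists [:: g]; split=> //; last by rewrite big_seq1.
by move=> s; rewrite inE => /eqP->.
Qed.

Lemma has_wordM S m n g h : has_word S m g -> has_word S n h ->
  has_word S (m + n) (g * h)%g.
Proof.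
move=> [w [h1 h2 h3]] [w' [h1' h2' h3']]; exists (w ++ w'); split.
- by move=> s; rewrite mem_cat => /orP[/h1|/h1'].
- by rewrite big_cat /= h2 h2'.
- by rewrite size_cat leq_add.
Qed.

Lemma has_wordX S n g : S g -> has_word S n (g ^+ n)%g.
Proof.
move=> Sg; elim: n => [|n IH]; first exact: has_word1.
by rewrite expgS -add1n; apply: has_wordM IH; exact: has_word_gen.
Qed.

Lemma has_word_expz A alpha (z : int) :
  has_word (sdprod_gens A alpha) `|z|%N (expgz alpha z).
Proof.
case: z => n /=; first by apply: has_wordX; right; left.
by rewrite -expVgn; apply: has_wordX; right; right.
Qed.

Lemma word_length_le S n g : has_word S n g -> word_length R S g <= n%:R.
Proof.
move=> [w [h1 h2 h3]]; apply: (@le_trans _ _ (size w)%:R); last by rewrite ler_nat.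
apply: ge_inf; first by exists 0 => _ [w' _ <-].
by exists w.
Qed.

Lemma word_length_ge S n g (B : R) : has_word S n g ->
  (forall w : seq Gam, (forall s, s \in w -> S s) ->
     (\big[*%g/1%g]_(s <- w) s) = g -> B <= (size w)%:R) ->
  B <= word_length R S g.
Proof.
move=> [w [h1 h2 h3]] hB; apply: lb_le_inf; first by exists (size w)%:R, w.
by move=> _ [w' [h1' h2'] <-]; exact: hB.
Qed.

Lemma has_word_of_length S n g m : has_word S n g -> word_length R S g < m%:R ->
  has_word S m g.
Proof.
move=> hn hlt; apply: contrapT => hno; move: hlt; apply/negP; rewrite -leNgt.
apply: word_length_ge hn _ => w h1 h2; rewrite ler_nat leqNgt; apply/negP => hw.
by apply: hno; exists w; split=> //; exact: ltnW.
Qed.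

Lemma sdprod_cycM alpha g h : sdprod_cyc (@derived Gam) alpha g ->
  sdprod_cyc (@derived Gam) alpha h -> sdprod_cyc (@derived Gam) alpha (g * h)%g.
Proof.
move=> [[a m] /= da <-] [[b n] /= db <-].
exists (a * conj_by (expgz alpha m) b, m + n)%g => /=.
  by apply: derivedM => //; exact: derived_conj_by.
by rewrite expgzD /conj_by !mulgA mulgVK.
Qed.

Lemma sdprod_cycV alpha g : sdprod_cyc (@derived Gam) alpha g ->
  sdprod_cyc (@derived Gam) alpha g^-1%g.
Proof.
move=> [[a m] /= da <-]; exists (conj_by (expgz alpha (- m)) a^-1%g, - m)%g => /=.
  by apply: derived_conj_by; exact: derivedV.
by rewrite /conj_by !expgzN invgK invgM mulgK.
Qed.

Lemma sdprod_cyc1 alpha : sdprod_cyc (@derived Gam) alpha 1%g.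
Proof. by exists (1%g, 0); [exact: derived1 | rewrite mul1g]. Qed.

End Words.

Section InclusionQI.
Variables (R : realType) (X : metricType R) (Gam : groupType).
Variable act : Gam -> X -> X.
Hypothesis act_isom : isometric_action act.
Hypothesis X_geodesic : geodesic_space X.
Implicit Types (g h alpha : Gam) (A : set Gam) (x y o : X).

Lemma orbit_distE x g h : orbit_dist act x g h = mdist x (act (g^-1 * h)%g x).
Proof. by rewrite /orbit_dist act_distl // -actM // invgK -actM. Qed.

Lemma inclusion_qi_base alpha A x y :
  inclusion_qi act alpha A x -> inclusion_qi act alpha A y.
Proof.
move=> [L [C [L1 C0 hLC hdense]]].
have e0 : 0 <= mdist x y by exact: mdist_ge0.
have close g h : `|orbit_dist act x g h - orbit_dist act y g h| <= 2 * mdist x y.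
  rewrite /orbit_dist.
  have := metric_triangle (act g x) (act g y) (act h x).
  have := metric_triangle (act g y) (act h y) (act h x).
  have := metric_triangle (act g y) (act g x) (act h y).
  have := metric_triangle (act g x) (act h x) (act h y).
  rewrite !(act_dist act_isom) (metric_sym y x) => ? ? ? ?.
  by apply/ler_normlP; split; lra.
exists L, (C + 2 * mdist x y); split=> // [|s t hs ht|u].
- by lra.
- have [h1 h2] := hLC s t hs ht; have /ler_normlP[] := close s t; split; lra.
- have [s hs h] := hdense u; exists s => //.
  by have /ler_normlP[] := close s u; rewrite /= in h *; lra.
Qed.

(** Milnor-Schwarz: along a geodesic of [X], elements of the orbit give a word
    with a bounded number of letters for each unit of length. *)
Lemma inclusion_qi_of_local_words alpha A o (K r : R) :
  (forall a, A a -> mdist o (act a o) <= K) ->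
  (forall y, exists2 g, sdprod_cyc (@derived Gam) alpha g & mdist (act g o) y <= r) ->
  (forall D : R, exists n : nat, forall g, sdprod_cyc (@derived Gam) alpha g ->
     mdist o (act g o) <= D -> has_word (sdprod_gens A alpha) n g) ->
  inclusion_qi act alpha A o.
Proof.
move=> hK hr hloc.
pose G := sdprod_cyc (@derived Gam) alpha; pose S := sdprod_gens A alpha.
have [n hn] := hloc (1 + 2 * r).
have r0 : 0 <= r.
  by have [g _ h] := hr o; apply: le_trans h; exact: mdist_ge0.
pose K1 := Num.max K (mdist o (act alpha o)).
have [K1K K1a] : K <= K1 /\ mdist o (act alpha o) <= K1.
  by rewrite /K1 !le_max !lexx orbT.
have hS s : S s -> mdist o (act s o) <= K1.
  move=> [/hK h|[->|->]] //; first exact: le_trans K1K.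
  by rewrite orbit_distV.
have upper (w : seq Gam) : (forall s, s \in w -> S s) ->
    mdist o (act (\big[*%g/1%g]_(s <- w) s) o) <= K1 * (size w)%:R.
  elim: w => [|s w IH] hw; first by rewrite big_nil act1 // mdistxx mulr0.
  rewrite big_cons /= -natr1 mulrDr mulr1.
  apply: le_trans (orbit_dist_mul act_isom _ _ _) _.
  rewrite addrC lerD //; last by apply: hS; apply: hw; rewrite mem_head.
  by apply: IH => t ht; apply: hw; rewrite in_cons ht orbT.
have lower g : G g -> exists2 m : nat, has_word S m g &
    m%:R <= n%:R * mdist o (act g o) + 2 * n%:R.
  move=> Gg; have [c [c0 c1 hc]] := X_geodesic o (act g o).
  set D := mdist o (act g o) in c1 hc *.
  have D0 : 0 <= D by exact: mdist_ge0.
  have [N [tt [ND tt0 ttN tt_in tt_step]]] := unit_subdivision D0.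
  have short a b : G a -> G b -> mdist (act a o) (act b o) <= 1 + 2 * r ->
      has_word S n (a^-1 * b)%g.
    move=> Ga Gb hab; apply: hn; first exact/sdprod_cycM/Gb/sdprod_cycV.
    by rewrite -orbit_distE.
  have chain i : (i <= N)%N -> exists a, [/\ G a, mdist (act a o) (c (tt i)) <= r
      & has_word S (i * n) a].
    elim: i => [_|i IH iN].
      exists 1%g; split; [exact: sdprod_cyc1 | | exact: has_word1].
      by rewrite act1 // tt0 c0 mdistxx.
    have [a [Ga ha wa]] := IH (ltnW iN).
    have [b Gb hb] := hr (c (tt i.+1)).
    exists b; split=> //; rewrite mulSn addnC -(mulVKg a b).
    apply: has_wordM wa _; apply: short => //.
    have := tt_step i; rewrite -hc ?in_itv /= ?tt_in ?(ltnW iN) //.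
    have := metric_triangle (act a o) (c (tt i)) (act b o).
    have := metric_triangle (c (tt i)) (c (tt i.+1)) (act b o).
    by rewrite (metric_sym (c (tt i.+1)) (act b o)); lra.
  have [a [Ga ha wa]] := chain N (leqnn N).
  exists (N * n + n)%N.
    rewrite -(mulVKg a g); apply: has_wordM wa _; apply: short => //.
    by move: ha; rewrite ttN c1; lra.
  rewrite natrD natrM.
  have : n%:R * N%:R <= n%:R * (D + 1) by exact: ler_wpM2l.
  by lra.
have K0 : 0 <= K1 by apply: le_trans K1a; exact: mdist_ge0.
have nR0 : 0 <= n%:R :> R by [].
have L0 : 0 < K1 + 1 + n%:R by lra.
exists (K1 + 1 + n%:R), (2 * n%:R + r); split=> [||s t Gs Gt|u].
- lra.
- lra.
- have Gst : G (s^-1 * t)%g by exact/sdprod_cycM/Gt/sdprod_cycV.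
  rewrite orbit_distE /word_dist; set g := (s^-1 * t)%g in Gst *.
  have [m wm hm] := lower g Gst; have D0 := mdist_ge0 o (act g o).
  have h1 := word_length_le R wm.
  have h2 : mdist o (act g o) / (K1 + 1) <= word_length R S g.
    apply: word_length_ge wm _ => w hw <-.
    rewrite ler_pdivrMr; last by lra.
    apply: le_trans (upper w hw) _; rewrite mulrC ler_wpM2l //; lra.
  rewrite -/S; split.
    rewrite lerBlDr mulrC ler_pdivrMr //.
    have : 0 <= K1 * mdist o (act g o) by exact: mulr_ge0.
    have : 0 <= (K1 + n%:R) * (2 * n%:R + r) by apply: mulr_ge0; lra.
    by lra.
  rewrite ler_pdivrMr in h2; last by lra.
  have : 0 <= n%:R * word_length R S g.
    by apply: mulr_ge0 => //; apply: word_length_ge wm _.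
  by lra.
- have [g Gg hg] := hr (act u o); exists g => //.
  by rewrite /orbit_dist /=; lra.
Qed.

End InclusionQI.

(** * From focal actions to confining automorphisms *)

Section RealCharacters.
Variables (R : realType) (Gam : groupType) (beta : Gam -> R).
Hypothesis betaM : forall g h, beta (g * h)%g = beta g + beta h.
Implicit Types g h : Gam.

Lemma char1 : beta 1%g = 0.
Proof. by have := betaM 1%g 1%g; rewrite mulg1; lra. Qed.

Lemma charV g : beta g^-1%g = - beta g.
Proof. by have := betaM g g^-1%g; rewrite mulgV char1; lra. Qed.

Lemma charX g (n : nat) : beta (g ^+ n)%g = n%:R * beta g.
Proof.
elim: n => [|n IH]; first by rewrite char1 mul0r.
by rewrite expgS betaM IH -natr1; lra.
Qed.

Lemma char_expz g (n : int) : beta (expgz g n) = n%:~R * beta g.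
Proof.
case: n => n /=; first by rewrite charX.
by rewrite charV charX NegzE mulrNz mulNr.
Qed.

Lemma char_derived h : derived h -> beta h = 0.
Proof.
apply: (smallest_sub (X := [set h | beta h = 0])).
  split=> /= [|a b ha hb|a ha]; first exact: char1.
    by rewrite betaM ha hb addr0.
  by rewrite charV ha oppr0.
by move=> _ [[a b] _ <-] /=; rewrite /commg /conjg !betaM !charV; lra.
Qed.

End RealCharacters.

Section FocalActions.
Variables (R : realType) (X : metricType R) (Gam : groupType).
Variable act : Gam -> X -> X.
Hypothesis act_isom : isometric_action act.
Hypothesis X_geodesic : geodesic_space X.
Variable delta : R.
Hypothesis hyp : hyperbolic_with X delta.
Implicit Types (g h s alpha : Gam) (A : set Gam) (x y o : X).
Implicit Types (xi eta : set (nat -> X)) (beta : Gam -> R).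

Let delta_ge0 : 0 <= delta. Proof. by case: hyp. Qed.

(** The horokernel is unbounded, while on the orbit of [o] it is [beta] up to a
    bounded error. *)
Lemma busemann_unbounded xi beta o (P : set Gam) (M : R) :
  fixed_by_all act xi -> busemann act xi beta ->
  (exists r : R, forall y, exists2 g, P g & mdist (act g o) y <= r) ->
  exists2 g, P g & M < beta g.
Proof.
move=> [hxi fxi] hb [r hr].
have [k hk] := horokernel_exists hxi.
have [y hy] := horokernel_unbounded hyp o (M + 2 * delta + r + 1) X_geodesic hxi hk.
have [g Pg hg] := hr y; exists g => //.
have := busemann_close act_isom hyp hxi fxi o g 1%N hb hk.
have := horokernel_le_dist (act g o) y hk.
have := horokernel_cocycle o (act g o) y hk.
rewrite expg1 mul1r => ? /ler_normlP[? ?] /ler_normlP[? ?].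
lra.
Qed.

(** If the derived subgroup has bounded orbits, then the sequence of the
    [s ^- n o], which goes away from [xi], tends to another point fixed by the
    whole group, because [s ^+ n * g * s ^- n * g^-1] is a commutator. *)
Lemma derived_unbounded xi beta o (K : R) : cobounded act ->
  regular_focal_at act xi beta ->
  ~ (forall h, derived h -> mdist o (act h o) <= K).
Proof.
move=> [x0 [r hcob]] [[fxi uniq _] hb betaM] hK; have d0 := delta_ge0.
have [hxi gxi] := fxi.
have [k hk] := horokernel_exists hxi.
have [s _ hs] : exists2 s, [set: Gam] s & delta < beta s.
  apply: (busemann_unbounded (o := o) _ fxi hb).
  exists (r + mdist o x0) => y; have [g hg] := hcob y; exists g => //.
  have := metric_triangle (act g o) (act g x0) y; rewrite (act_dist act_isom); lra.
have hD n : `|k (o, act (s ^+ n)%g o) - n%:R * beta s| <= 2 * delta.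
  exact: (busemann_close act_isom hyp hxi gxi).
have [C hC] := orbit_dist_linear act_isom hyp hk (ltW hs) hD.
pose v (n : nat) := act (s ^- n)%g o.
have hv n : `|mdist o (v n) - n%:R * beta s| <= C.
  by rewrite /v (orbit_distV act_isom).
have vv (i j : nat) : (i <= j)%N -> mdist (v i) (v j) <= (j%:R - i%:R) * beta s + C.
  move=> ij; have E : mdist (v i) (v j) = mdist o (v (j - i)%N).
    rewrite -[LHS]/(orbit_dist act o (s ^- i)%g (s ^- j)%g) (orbit_distE act_isom).
    by rewrite invgK -{1}(subnK ij) expgnDr invgM mulVKg.
  by rewrite E -natrB //; have /ler_normlP[_] := hv (j - i)%N; lra.
have vprod p (i j : nat) : (i <= j)%N ->
    i%:R * beta s - 2 * C - mdist o p <= gromov_product p (v i) (v j).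
  move=> /vv; have /ler_normlP[? ?] := hv i; have /ler_normlP[? ?] := hv j.
  have := metric_triangle o p (v i); have := metric_triangle o p (v j).
  have C0 : 0 <= C by apply: le_trans (hC 0%N).
  by rewrite /gromov_product !(metric_sym _ p); lra.
have gv : gromov_sequence v.
  move=> p M; have bs0 : 0 < beta s by lra.
  have Mn (n : nat) : ((Num.truncn ((`|M| + 2 * C + mdist o p) / beta s)).+1 <= n)%N ->
      M <= n%:R * beta s - 2 * C - mdist o p.
    move=> hn; suff : (`|M| + 2 * C + mdist o p) <= n%:R * beta s.
      by have := ler_norm M; lra.
    rewrite -ler_pdivrMr //; apply/ltW/(lt_le_trans (truncnS_gt _)).
    by rewrite ler_nat.
  exists (Num.truncn ((`|M| + 2 * C + mdist o p) / beta s)).+1 => m n hm hn.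
  have [mn|/ltnW nm] := leqP m n; first exact: le_trans (Mn _ hm) (vprod _ _ _ mn).
  by rewrite gromov_productC; exact: le_trans (Mn _ hn) (vprod _ _ _ nm).
pose eta : set (nat -> X) := [set w | gromov_sequence w /\ gromov_equiv v w].
have heta : gromov_boundary eta by exists v.
have etaxi : eta = xi.
  apply: uniq; split=> // g; apply: (fixes_of_equiv act_isom hyp (u := v)) => //.
  apply: (@gromov_equiv_near _ _ (K + mdist o (act g o))) => //.
  exists 0%N => n _ /=; rewrite /v -(actM act_isom).
  rewrite -[leLHS]/(orbit_dist act o (s ^- n)%g (g * s ^- n)%g) (orbit_distE act_isom).
  rewrite invgK; have -> : (s ^+ n * (g * s ^- n) = [~ s ^- n, g^-1] * g)%g.
    by rewrite /commg /conjg !invgK !mulgA mulgVK.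
  apply: le_trans (orbit_dist_mul act_isom _ _ _) _.
  by rewrite lerD2r; apply: hK; exact: derivedR.
have xiv : xi v by rewrite -etaxi.
have [N hN] := horokernel_converging hyp o (2 * delta + C + 1) hxi hk xiv.
have := hN N (leqnn N); have /ler_normlP[_] := hv N.
have := busemann_close act_isom hyp hxi gxi o (s ^- N)%g 1%N hb hk.
rewrite expg1 mul1r -/(v N) (charV betaM) (charX betaM) => /ler_normlP[? ?].
by lra.
Qed.

(** Conjugation by high powers of [s^-1] brings the elements with [beta] small into
    the [K]-ball. For the elements of the derived subgroup, this makes it
    confining into the union of the images of this ball; for the others, it shows
    that their commutators with powers of [s] stay close to them, so that the
    orbit of [G] is coarsely dense. *)
Lemma regular_focal_confining xi beta : cobounded act ->
  regular_focal_at act xi beta ->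
  exists (alpha : Gam) (A : set Gam), confining_pair act alpha A.
Proof.
move=> hcob freg; have d0 := delta_ge0.
have [[fxi uniq _] hb betaM] := freg; have [hxi gxi] := fxi.
case: (hcob) => o [r hr].
have [k hk] := horokernel_exists hxi.
have hkb g : `|k (o, act g o) - beta g| <= 2 * delta.
  by have := busemann_close act_isom hyp hxi gxi o g 1%N hb hk; rewrite expg1 mul1r.
have [s _ hs] : exists2 s, [set: Gam] s & delta < beta s.
  apply: (busemann_unbounded (o := o) _ fxi hb).
  by exists r => y; have [g hg] := hr y; exists g.
have bs0 : 0 < beta s by lra.
have hD n : `|k (o, act (s ^+ n)%g o) - n%:R * beta s| <= 2 * delta.
  exact: (busemann_close act_isom hyp hxi gxi).
(* [s] pushes towards [xi], and the conjugation that contracts goes back along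
   the orbit of [s] *)
pose alpha := (s^-1)%g.
have conjE g n : conj_by (alpha ^+ n)%g g = (s ^- n * g * s ^+ n)%g.
  by rewrite /conj_by /alpha expVgn invgK.
have balpha (z : int) : beta (expgz alpha z) = - z%:~R * beta s.
  by rewrite (char_expz betaM) (charV betaM); lra.
have [K0 hK0] := conj_contraction act_isom hyp (2 * delta + beta s) hxi hk (ltW hs) hD.
pose K := `|K0|; have K_ge0 : 0 <= K by exact: normr_ge0.
have contr (D : R) : exists N : nat, forall n g, (N <= n)%N -> `|beta g| <= beta s ->
    mdist o (act g o) <= D -> mdist o (act (conj_by (alpha ^+ n)%g g) o) <= K.
  exists (Num.truncn (D / beta s)).+1 => n g hn /ler_normlP[? ?] hg.
  rewrite conjE; apply: le_trans (ler_norm K0); apply: hK0 => //.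
    by have /ler_normlP[? ?] := hkb g; apply/ler_normlP; split; lra.
  apply: le_trans hg _; have : D <= n%:R * beta s; last first.
    have : 0 <= n%:R * beta s by apply: mulr_ge0 => //; exact: ltW.
    by lra.
  rewrite -ler_pdivrMr //; apply/ltW/(lt_le_trans (truncnS_gt _)).
  by rewrite ler_nat.
have bder h : derived h -> `|beta h| <= beta s.
  by move=> /(char_derived betaM) ->; rewrite normr0 ltW.
pose A : set Gam := [set a | exists n h,
  [/\ derived h, mdist o (act h o) <= K & a = conj_by (alpha ^+ n)%g h]].
have Ader : A `<=` @derived Gam.
  by move=> _ [n [h [dh _ ->]]]; exact: derived_conj_by.
have ball_A h : derived h -> mdist o (act h o) <= K -> A h.
  by move=> dh hh; exists 0%N, h; rewrite expg0 conj_by1.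
have [K' hK'] : exists K' : R, forall a, A a -> mdist o (act a o) <= K'.
  have [N hN] := contr K.
  exists (K + 2 * (N%:R * mdist o (act alpha o))) => _ [n [h [dh hh ->]]].
  have e0 : 0 <= N%:R * mdist o (act alpha o) by rewrite mulr_ge0 ?mdist_ge0.
  have [Nn|nN] := leqP N n.
    by have := hN n h Nn (bder h dh) hh; lra.
  rewrite /conj_by.
  have h1 := orbit_dist_mul act_isom o (alpha ^+ n * h)%g (alpha ^- n)%g.
  have h2 := orbit_dist_mul act_isom o (alpha ^+ n)%g h.
  have h3 := orbit_dist_exp act_isom o alpha n.
  have h4 : n%:R * mdist o (act alpha o) <= N%:R * mdist o (act alpha o).
    by apply: ler_wpM2r; [exact: mdist_ge0 | rewrite ler_nat ltnW].
  by rewrite (orbit_distV act_isom) in h1; lra.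
have Aphi n a : A a -> A (conj_by (alpha ^+ n)%g a).
  by move=> [m [h [dh hh ->]]]; exists (n + m)%N, h; rewrite expgnDr conj_byM.
have absorb h : derived h -> exists n : nat, A (conj_by (alpha ^+ n)%g h).
  move=> dh; have [N hN] := contr (mdist o (act h o)).
  exists N; apply: ball_A; first exact: derived_conj_by.
  by apply: hN => //; exact: bder.
have qi : inclusion_qi act alpha A o.
  apply: (inclusion_qi_of_local_words act_isom X_geodesic (K := K') (r := K + r)) => //.
    move=> y; have [g hg] := hr y.
    (* [alpha ^ m * g] almost preserves the level of [o], so its commutator with a
       high power of [alpha] moves [o] almost to the same point *)
    pose m := Num.floor (beta g / beta s); pose g' := (expgz alpha m * g)%g.
    have hg' : `|beta g'^-1%g| <= beta s.
      rewrite (charV betaM) normrN betaM balpha.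
      have := Num.Theory.floor_itv (beta g / beta s).
      rewrite ler_pdivlMr // ltr_pdivrMr // -/m intrD => /andP[q1 q2].
      by apply/ler_normlP; split; lra.
    have [N hN] := contr (mdist o (act g'^-1%g o)).
    have q := hN N _ (leqnn N) hg' (lexx _).
    pose h := [~ g'^-1, alpha ^- N]%g.
    exists (expgz alpha (- m) * h)%g.
      apply: sdprod_cycM; last by exists (h, 0); [exact: derivedR | rewrite /= mulg1].
      by exists (1%g, - m); [exact: derived1 | rewrite /= mul1g].
    apply: le_trans (metric_triangle _ (act g o) _) _; rewrite lerD //.
    rewrite (actM act_isom) (act_distl act_isom) -(actM act_isom) expgzN invgK -/g'.
    rewrite -[leLHS]/(orbit_dist act o h g') (orbit_distE act_isom).
    have -> : (h^-1 * g' = (conj_by (alpha ^+ N) g'^-1)^-1)%g.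
      exact: commgVV_mul.
    by rewrite (orbit_distV act_isom).
  move=> D; pose Z := (Num.truncn ((`|D| + 2 * delta) / beta s)).+1.
  have [N hN] := contr (D + Z%:R * mdist o (act alpha o)).
  exists (N + 1 + N + Z)%N => _ [[h z] /= dh <-] hD'.
  have hz : `|z%:~R| <= Z%:R :> R.
    apply/ltW/(le_lt_trans _ (truncnS_gt _)); rewrite ler_pdivlMr //.
    rewrite -(gtr0_norm bs0) -normrM.
    have := hkb (h * expgz alpha z)%g.
    rewrite betaM (char_derived betaM dh) balpha add0r.
    have /ler_normlP[? ?] := horokernel_le_dist o (act (h * expgz alpha z)%g o) hk.
    have := ler_norm D => ? /ler_normlP[? ?].
    by apply/ler_normlP; split; lra.
  have Zn : (`|z|%N <= Z)%N by move: hz; rewrite -intr_norm -natr_absz ?ler_nat.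
  apply: (has_word_mono (m := N + 1 + N + `|z|%N)%N); first by rewrite leq_add2l.
  apply: has_wordM (has_word_expz _ _ _).
  have -> : h = (alpha^-1 ^+ N * conj_by (alpha ^+ N) h * alpha ^+ N)%g.
    by rewrite /conj_by expVgn !mulgA mulVg mul1g mulgVK.
  apply: has_wordM; last by apply: has_wordX; right; left.
  apply: has_wordM; first by apply: has_wordX; right; right.
  apply: has_word_gen; left; apply: ball_A; first exact: derived_conj_by.
  apply: hN => //; first exact: bder.
  have -> : h = (h * expgz alpha z * expgz alpha (- z))%g by rewrite expgzN mulgK.
  apply: le_trans (orbit_dist_mul act_isom _ _ _) _; rewrite lerD //.
  rewrite expgzN (orbit_distV act_isom).
  apply: le_trans (orbit_dist_expz act_isom _ _ _) _.
  by apply: ler_wpM2r hz; exact: mdist_ge0.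
exists alpha, A; split=> //; last by exists o.
- move=> n n0 /(char_derived betaM); rewrite -expgz_nat balpha => /eqP.
  by rewrite mulNr oppr_eq0 mulf_eq0 intr_eq0 (gt_eqF bs0) orbF; case: n n0.
- have iterE n h : iter n (conj_by alpha) h = conj_by (alpha ^+ n)%g h.
    exact: iter_conj_by.
  split; last first.
    split=> [_ [a Aa <-]|AA]; first by have := Aphi 1%N a Aa; rewrite expg1.
    have AAn n a : A a -> exists2 b, A b & a = conj_by (alpha ^+ n)%g b.
      elim: n a => [|n IH] a Aa; first by exists a; rewrite ?expg0 ?conj_by1.
      have [b Ab ->] := IH a Aa; have [c Ac <-] := AA b Ab.
      by exists c => //; rewrite -conj_byM -expgSr.
    apply: (derived_unbounded (K := K') (o := o) hcob freg) => h dh.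
    have [n An] := absorb h dh; have [b Ab] := AAn n _ An.
    by rewrite !conj_byE => /conjg_inj ->; exact: hK'.
  split=> //.
  + exact: conj_by_automorphism.
  + by move=> _ [a Aa <-]; have := Aphi 1%N a Aa; rewrite expg1.
  + apply/seteqP; split=> [h dh|h [n _ [dh _]]] //.
    by have [n An] := absorb h dh; exists n => //; split=> //; rewrite iterE.
  + have [N hN] := contr (2 * K').
    exists N => a b Aa Ab; rewrite iterE; apply: ball_A.
      by apply: derived_conj_by; apply: derivedM; exact: Ader.
    apply: hN => //; first by apply: bder; apply: derivedM; exact: Ader.
    apply: le_trans (orbit_dist_mul act_isom _ _ _) _.
    by have := hK' a Aa; have := hK' b Ab; lra.
Qed.

End FocalActions.

(** * Confining automorphisms *)

Section ConfiningSets.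
Variables (Gam : groupType) (alpha : Gam) (A : set Gam).
Hypothesis A_confining : confining (@derived Gam) (conj_by alpha) A.
Implicit Types (g h a b : Gam) (m n : nat) (z : int).

Let phi z h := conj_by (expgz alpha z) h.

Lemma phiD z z' h : phi (z + z') h = phi z (phi z' h).
Proof. by rewrite /phi expgzD conj_byM. Qed.

Lemma phi_iter n h : iter n (conj_by alpha) h = phi n h.
Proof. exact: iter_conj_by. Qed.

Lemma phi_derived z h : derived h -> derived (phi z h).
Proof. exact: derived_conj_by. Qed.

Lemma confining_derived a : A a -> derived a.
Proof. by case: A_confining => _ h _ _ _; exact: h. Qed.

Lemma confining_phi z a : 0 <= z -> A a -> A (phi z a).
Proof.
case: z => // n _ Aa; rewrite -phi_iter; elim: n => //= n IH.
by case: A_confining => _ _ h _ _; apply: h; exists (iter n (conj_by alpha) a).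
Qed.

Lemma confining_mono z z' h : z <= z' -> A (phi z h) -> A (phi z' h).
Proof.
move=> zz' /(confining_phi (z := z' - z)); rewrite -phiD subrK; apply.
by rewrite subr_ge0.
Qed.

Lemma confining_absorbs h : derived h -> exists n : nat, A (phi n h).
Proof.
case: A_confining => _ _ _ hU _ dh; have : derived h by [].
by rewrite {1}hU => -[n _ [_ An]]; exists n; rewrite -phi_iter.
Qed.

Lemma confining1 : A 1%g.
Proof.
have [n] := confining_absorbs (@derived1 Gam).
by rewrite /phi conj_byE conj1g.
Qed.

Lemma confiningM : exists n0 : nat, forall a b, A a -> A b -> A (phi n0 (a * b)%g).
Proof.
case: A_confining => _ _ _ _ [n0 hn0]; exists n0 => a b Aa Ab.
by rewrite -phi_iter; exact: hn0.
Qed.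

(** The part in the derived subgroup of a word of length [m] is a product of at
    most [m] elements of sets [phi z A] with [`|z| <= m], which a power of [alpha]
    that depends on [m] alone brings into [A]. *)
Lemma word_normal_form : exists n0 : nat, forall m g,
  has_word (sdprod_gens A alpha) m g -> exists h z,
  [/\ derived h, g = (h * expgz alpha z)%g, `|z| <= m%:Z & A (phi (m * n0)%N h)].
Proof.
have [n0 hn0] := confiningM; exists n0.+1 => m g [w [hw <- sw]].
elim: w m hw sw => [|s w IH] m hw sw.
  exists 1%g, 0; rewrite big_nil expgz0 mulg1; split=> //; first exact: derived1.
  by rewrite /phi conj_byE conj1g; exact: confining1.
case: m sw => // m sw.
have [|h [z [dh E hz Ah]]] := IH m _ sw.
  by move=> t ht; apply: hw; rewrite in_cons ht orbT.
have E1 : ((m.+1 * n0.+1)%N : int) = n0%:Z + (1 + (m * n0.+1)%N%:Z) by lia.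
have : sdprod_gens A alpha s by apply: hw; rewrite mem_head.
rewrite big_cons E => -[As|[->|->]].
- exists (s * h)%g, z; split.
  + by apply: derivedM => //; exact: confining_derived.
  + by rewrite mulgA.
  + by lia.
  + rewrite E1 phiD [phi (1 + _) _]conj_by_mul; apply: hn0.
      by apply: confining_phi As; lia.
    by apply: confining_mono Ah; lia.
- exists (phi 1 h), (1 + z); split.
  + exact: phi_derived.
  + by rewrite expgzD /phi /conj_by expgz_nat expg1 !mulgA mulgVK.
  + by lia.
  + by rewrite -phiD; apply: confining_mono Ah; lia.
- exists (phi (- 1) h), (- 1 + z); split.
  + exact: phi_derived.
  + by rewrite expgzD /phi /conj_by expgzN expgz_nat expg1 !mulgA mulgVK.
  + by lia.
  + by rewrite -phiD; apply: confining_mono Ah; lia.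
Qed.

Lemma sdprod_has_word g : sdprod_cyc (@derived Gam) alpha g ->
  exists m, has_word (sdprod_gens A alpha) m g.
Proof.
move=> [[h z] /= dh <-]; have [n An] := confining_absorbs dh.
exists (n + 1 + n + `|z|%N)%N; apply: has_wordM (has_word_expz _ _ _).
have -> : h = (alpha^-1 ^+ n * phi n h * alpha ^+ n)%g.
  by rewrite /phi /conj_by expVgn !mulgA mulVg mul1g mulgVK.
apply: has_wordM; last by apply: has_wordX; right; left.
apply: has_wordM; first by apply: has_wordX; right; right.
by apply: has_word_gen; left.
Qed.

Lemma sdprod_cyc_inj h h' z z' : infinite_order_mod (@derived Gam) alpha ->
  derived h -> derived h' ->
  (h * expgz alpha z = h' * expgz alpha z')%g -> h = h' /\ z = z'.
Proof.
move=> ainf dh dh' E.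
have E' : (h'^-1 * h = expgz alpha (z' - z))%g.
  by rewrite expgzD expgzN -(mulKg h' (expgz alpha z')) -E mulgA mulgK.
have dz : derived (expgz alpha (z' - z)).
  by rewrite -E'; apply: derivedM => //; exact: derivedV.
have zz : z' - z = 0.
  case: (z' - z) dz => [[|n]|n] //= hd; first by case: (ainf n.+1).
  by case: (ainf n.+1 isT); rewrite -[X in derived X]invgK; exact: derivedV.
split; last by lia.
by move: E'; rewrite zz expgz0 => /mulg1_eq; rewrite invgK.
Qed.

(** [A] need not be symmetric, but the merging level of two elements has to be;
    conjugation by [alpha] is confining into the symmetric part too. *)
Definition sympart : set Gam := [set a | A a /\ A a^-1%g].

Lemma sympartV a : sympart a -> sympart a^-1%g.
Proof. by move=> [? ?]; split; rewrite ?invgK. Qed.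

Lemma sympart1 : sympart 1%g.
Proof. by split; rewrite ?invg1; exact: confining1. Qed.

Lemma sympart_phi1 z : sympart (phi z 1%g).
Proof. by rewrite /phi conj_byE conj1g; exact: sympart1. Qed.

Lemma sympart_mono z z' h : z <= z' -> sympart (phi z h) -> sympart (phi z' h).
Proof.
rewrite /sympart /phi /= -!conj_byV => zz' [h1 h2]; split; exact: confining_mono zz' _.
Qed.

Lemma sympart_absorbs h : derived h -> exists n : nat, sympart (phi n h).
Proof.
move=> dh; have [n hn] := confining_absorbs dh.
have [m hm] := confining_absorbs (derivedV dh).
exists (maxn m n); rewrite /sympart /= -conj_byV.
by split; [apply: confining_mono hn | apply: confining_mono hm]; lia.
Qed.

Lemma sympartM : exists n0 : nat, forall z g h,
  sympart (phi z g) -> sympart (phi z h) -> sympart (phi (z + n0%:Z) (g * h)%g).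
Proof.
have [n0 hn0] := confiningM; exists n0 => z g h [h1 h2] [h3 h4].
rewrite addrC phiD [phi z _]conj_by_mul; split; first exact: hn0.
by rewrite /phi -conj_byV invgM; exact: hn0.
Qed.

End ConfiningSets.

(** * The tree-like model of a confining pair *)

Section ConfiningPairs.
Variables (R : realType) (X : metricType R) (Gam : groupType).
Variable act : Gam -> X -> X.
Hypothesis act_isom : isometric_action act.
Variables (alpha : Gam) (A : set Gam).
Hypothesis pair : confining_pair act alpha A.
Implicit Types (g h a : Gam) (x y o : X) (z : int).

Let A_conf : confining (@derived Gam) (conj_by alpha) A.
Proof. by case: pair => _ _ [].  Qed.

Let phi z h := conj_by (expgz alpha z) h.

Lemma pair_inclusion_qi o : inclusion_qi act alpha A o.
Proof. by case: pair => _ _ _ [x]; exact: inclusion_qi_base. Qed.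

Lemma pair_displacement o : exists2 K : R, 0 <= K &
  forall a, A a -> mdist o (act a o) <= K.
Proof.
have [L [C [L1 C0 hLC _]]] := pair_inclusion_qi o.
exists (L + C) => [|a Aa]; first by lra.
have G1 := sdprod_cyc1 alpha.
have Ga : sdprod_cyc (@derived Gam) alpha a.
  by exists (a, 0); [exact: confining_derived A_conf _ Aa | rewrite /= mulg1].
have [_] := hLC 1%g a G1 Ga.
rewrite orbit_distE // /word_dist invg1 mul1g => h; apply: le_trans h _.
rewrite lerD2r -[leRHS]mulr1 ler_wpM2l //; first by lra.
by apply: (@word_length_le R _ _ 1%N); apply: has_word_gen; left.
Qed.

Lemma pair_dense o : cobounded act -> exists2 r : R, 0 <= r &
  forall y, exists2 g, sdprod_cyc (@derived Gam) alpha g & mdist (act g o) y <= r.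
Proof.
move=> [x0 [r0 hr0]]; have [L [C [L1 C0 _ hd]]] := pair_inclusion_qi o.
have r00 : 0 <= r0 by have [g hg] := hr0 o; apply: le_trans hg; exact: mdist_ge0.
have e0 : 0 <= mdist o x0 by exact: mdist_ge0.
exists (C + mdist o x0 + r0) => [|y]; first by lra.
have [u hu] := hr0 y; have [g Gg hg] := hd u; exists g => //.
have := metric_triangle (act g o) (act u o) y.
have := metric_triangle (act u o) (act u x0) y.
by rewrite (act_dist act_isom); move: hg; rewrite /orbit_dist /=; lra.
Qed.

(** An element of small displacement is a short word, whose normal form is brought
    into [A] by a bounded power of [alpha]; the inverse has the same
    displacement. *)
Lemma pair_proper o (r : R) : exists N : nat, forall h z, derived h ->
  mdist o (act (h * expgz alpha z)%g o) <= r ->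
  `|z| <= N%:Z /\ sympart A (phi N h).
Proof.
have [L [C [L1 C0 hLC _]]] := pair_inclusion_qi o.
have [n0 hn0] := word_normal_form A_conf.
have L0 : 0 < L by lra.
pose m := (Num.truncn (L * (r + C))).+1.
have ainf : infinite_order_mod (@derived Gam) alpha by case: pair.
have half h z : derived h -> mdist o (act (h * expgz alpha z)%g o) <= r ->
    `|z| <= m%:Z /\ A (phi (m * n0)%N h).
  move=> dh hd; have G1 := sdprod_cyc1 alpha.
  have Gg := sdprod_cyc_mem alpha z dh.
  have [+ _] := hLC 1%g _ G1 Gg.
  rewrite orbit_distE // /word_dist invg1 mul1g => hw.
  have {}hw : word_length R (sdprod_gens A alpha) (h * expgz alpha z)%g < m%:R.
    apply: le_lt_trans (truncnS_gt _); rewrite mulrC -ler_pdivrMr // mulrC.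
    by lra.
  have [n wn] := sdprod_has_word A_conf Gg.
  have [h' [z' [dh' E hz Ah]]] := hn0 _ _ (has_word_of_length wn hw).
  by have [-> ->] := sdprod_cyc_inj ainf dh dh' E.
exists (m * n0 + m)%N => h z dh hd; have [hz Ah] := half h z dh hd.
have [_ Ah'] : `|- z| <= m%:Z /\
    A (phi (m * n0)%N (conj_by (expgz alpha (- z)) h^-1%g)).
  apply: half; first by apply: derived_conj_by; exact: derivedV.
  have -> : (conj_by (expgz alpha (- z)) h^-1 * expgz alpha (- z) =
      (h * expgz alpha z)^-1)%g.
    by rewrite /conj_by expgzN invgK invgM mulgK.
  by rewrite (orbit_distV act_isom).
split; first by lia.
split; first by apply: (confining_mono A_conf) Ah; lia.
rewrite -conj_byV.
apply: (@confining_mono _ _ _ A_conf ((m * n0)%N%:Z - z)); first by lia.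
by rewrite phiD.
Qed.

Definition sdprod_model : Type := ({h : Gam | derived h} * int)%type.
Implicit Types (p q : sdprod_model).

Definition model_elt p : Gam := (sval p.1 * expgz alpha p.2)%g.

(** The descents [h * alpha ^ i] and [h' * alpha ^ i], with [i] going to minus
    infinity, merge at the level [- n] as soon as [phi n (h^-1 * h')] is small. *)
Definition merging_levels p q : set R :=
  [set n%:~R | n in [set n : int | [/\ - p.2 <= n, - q.2 <= n &
     sympart A (phi n ((sval p.1)^-1 * sval q.1)%g)]]].

Definition merging_level p q : R := inf (merging_levels p q).

(** The length of the path that goes down from [p] to the merging level, at
    [- merging_level p q], and up to [q]. *)
Definition model_dist p q : R := 2 * merging_level p q + p.2%:~R + q.2%:~R.

Lemma merging_levels_lb p q : lbound (merging_levels p q) (- p.2%:~R) /\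
  lbound (merging_levels p q) (- q.2%:~R).
Proof.
by split=> _ [n [h1 h2 _] <-]; rewrite -intrN ler_int.
Qed.

Lemma merging_levels_inf p q : has_inf (merging_levels p q).
Proof.
split; last by exists (- p.2%:~R); case: (merging_levels_lb p q).
have dh : derived ((sval p.1)^-1 * sval q.1)%g.
  by apply: derivedM; [apply: derivedV; exact: (svalP p.1) | exact: (svalP q.1)].
have [n hn] := sympart_absorbs A_conf dh.
pose m : int := n%:Z + `|p.2| + `|q.2|.
exists m%:~R, m => //; split; [by lia | by lia|].
by apply: (sympart_mono A_conf) hn; lia.
Qed.

Lemma merging_level_le p q (n : int) : - p.2 <= n -> - q.2 <= n ->
  sympart A (phi n ((sval p.1)^-1 * sval q.1)%g) -> merging_level p q <= n%:~R.
Proof.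
move=> h1 h2 h3; apply: ge_inf; last by exists n.
by case: (merging_levels_inf p q).
Qed.

Lemma merging_level_ge p q :
  - p.2%:~R <= merging_level p q /\ - q.2%:~R <= merging_level p q.
Proof.
by split; apply: lb_le_inf; try (by case: (merging_levels_inf p q));
  case: (merging_levels_lb p q).
Qed.

Lemma merging_level_attained p q : exists n : int, [/\ - p.2 <= n, - q.2 <= n,
  sympart A (phi n ((sval p.1)^-1 * sval q.1)%g) & n%:~R <= merging_level p q + 1].
Proof.
have [_ [n [h1 h2 h3] <-] hlt] := inf_adherent ltr01 (merging_levels_inf p q).
by exists n; split=> //; exact: ltW.
Qed.

Lemma merging_level_sym p q : merging_level p q = merging_level q p.
Proof.
rewrite /merging_level; congr inf.
have sub p' q' : merging_levels p' q' `<=` merging_levels q' p'.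
  move=> _ [n [h1 h2 h3] <-]; exists n => //; split=> //.
  have -> : ((sval q'.1)^-1 * sval p'.1 = ((sval p'.1)^-1 * sval q'.1)^-1)%g.
    by rewrite invgM invgK.
  by rewrite /phi conj_byV; exact: sympartV.
by apply/seteqP; split; exact: sub.
Qed.

Lemma merging_level_refl p : merging_level p p = - p.2%:~R.
Proof.
apply/eqP; rewrite eq_le; case: (merging_level_ge p p) => -> _; rewrite andbT.
rewrite -intrN; apply: merging_level_le => //.
by rewrite mulVg; exact: (sympart_phi1 A_conf).
Qed.

(** At a level where both pairs have merged, [h^-1 * h''] is a product of two
    elements of [A], and [n0] more steps absorb it. *)
Lemma merging_level_ultrametric : exists2 c : R, 0 <= c & forall p q t,
  merging_level p t <= merging_level p q + c \/
  merging_level p t <= merging_level q t + c.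
Proof.
have [n0 hn0] := sympartM A_conf; exists (n0%:R + 1) => [|p q t].
  by have : 0 <= n0%:R :> R by []; lra.
have [m [m1 m2 m3 m4]] := merging_level_attained p q.
have [n [n1 n2 n3 n4]] := merging_level_attained q t.
have key (j : int) : m <= j -> n <= j -> merging_level p t <= j%:~R + n0%:R.
  move=> mj nj; have -> : j%:~R + n0%:R = (j + n0%:Z)%:~R :> R by rewrite intrD.
  apply: merging_level_le; [by lia | by lia|].
  have -> : ((sval p.1)^-1 * sval t.1 =
      ((sval p.1)^-1 * sval q.1) * ((sval q.1)^-1 * sval t.1))%g.
    by rewrite mulgA mulgK.
  by apply: hn0; [apply: (sympart_mono A_conf) m3 | apply: (sympart_mono A_conf) n3].
have [mn|/ltW nm] := leP m n.
- by right; have := key n mn (lexx _); lra.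
- by left; have := key m (lexx _) nm; lra.
Qed.

(** For an ultrametric, the two largest of the three sums over the pairings of four
    points are equal. *)
Lemma model_dist_rough_hyperbolic : exists delta, rough_hyperbolic model_dist delta.
Proof.
have [c c0 hc] := merging_level_ultrametric; exists (4 * c).
split=> [|p|p q|p q|p q s t].
- by lra.
- by rewrite /model_dist merging_level_refl; lra.
- by rewrite /model_dist merging_level_sym; lra.
- by have [? ?] := merging_level_ge p q; rewrite /model_dist; lra.
rewrite -lerBlDr le_max /model_dist.
suff : merging_level p q + merging_level s t <=
      merging_level p s + merging_level q t + 2 * c \/
    merging_level p q + merging_level s t <=
      merging_level p t + merging_level q s + 2 * c.
  by case=> ?; apply/orP; [left|right]; lra.
have := hc p s q; have := hc p t q; have := hc s p t; have := hc s q t.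
rewrite (merging_level_sym s q) (merging_level_sym t q) (merging_level_sym s p).
have [?|?] := leP (merging_level p s + merging_level q t)
  (merging_level p t + merging_level q s).
- by case=> ? [?|?] [?|?] [?|?]; right; lra.
- by case=> ? [?|?] [?|?] [?|?]; left; lra.
Qed.

End ConfiningPairs.

(** * From confining automorphisms to focal actions *)

Section ConfiningImpliesFocal.
Variables (R : realType) (X : metricType R) (Gam : groupType).
Variable act : Gam -> X -> X.
Hypothesis act_isom : isometric_action act.
Hypothesis act_cobounded : cobounded act.
Hypothesis X_geodesic : geodesic_space X.
Variables (alpha : Gam) (A : set Gam).
Hypothesis pair : confining_pair act alpha A.
Implicit Types (g h a : Gam) (x y o : X) (z : int) (xi eta : set (nat -> X)).

Let A_conf : confining (@derived Gam) (conj_by alpha) A.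
Proof. by case: pair => _ _ [].  Qed.

Let model := sdprod_model Gam.
Let rho : model -> model -> R := model_dist R alpha A.

Lemma model_dist_step o (D : R) : exists N : nat, forall p q : model,
  orbit_dist act o (model_elt alpha p) (model_elt alpha q) <= D -> rho p q <= 3 * N%:R.
Proof.
have [N hN] := pair_proper act_isom pair o D; exists N => -[[h dh] i] [[h' dh'] j].
rewrite orbit_distE //; set u := (h^-1 * h')%g.
have du : derived u by apply: derivedM => //; exact: derivedV.
have -> : ((model_elt alpha (exist _ h dh, i))^-1 *
      model_elt alpha (exist _ h' dh', j) =
    conj_by (expgz alpha (- i)) u * expgz alpha (j - i))%g.
  rewrite /model_elt /conj_by /= (addrC j) expgzD expgzN invgK invgM /u !mulgA.
  by rewrite mulgK.
move=> /hN []; first exact: derived_conj_by.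
rewrite -conj_byM -expgzD => hij hA.
have : merging_level R alpha A (exist _ h dh, i) (exist _ h' dh', j) <= (N%:Z - i)%:~R.
  by apply: (merging_level_le pair) => //=; lia.
rewrite /rho /model_dist /= intrB.
have : (j - i)%:~R <= N%:R :> R by rewrite -[N%:R]/(N%:Z%:~R) ler_int; lia.
by rewrite intrB; lra.
Qed.

Lemma model_dist_lower o : exists2 L : R, 0 <= L & forall p q : model,
  orbit_dist act o (model_elt alpha p) (model_elt alpha q) <= L * rho p q + L.
Proof.
have [K K0 hK] := pair_displacement act_isom pair o.
have e0 : 0 <= mdist o (act alpha o) by exact: mdist_ge0.
exists (K + 2 * mdist o (act alpha o)) => [|p q]; first by lra.
have [n [n1 n2 [An _] hn]] := merging_level_attained pair p q.
have descent (s : model) : - s.2 <= n ->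
    orbit_dist act o (model_elt alpha s) (sval s.1 * expgz alpha (- n))%g
      <= (s.2%:~R + n%:~R) * mdist o (act alpha o).
  move=> hs; rewrite orbit_distE //.
  have -> : ((model_elt alpha s)^-1 * (sval s.1 * expgz alpha (- n)) =
      expgz alpha (- (s.2 + n)))%g.
    by rewrite /model_elt invgM opprD expgzD -expgzN !mulgA mulgVK.
  apply: le_trans (orbit_dist_expz act_isom _ _ _) _; rewrite intrN normrN -intrD.
  by rewrite ger0_norm // ler0z; lia.
have middle : orbit_dist act o (sval p.1 * expgz alpha (- n))%g
    (sval q.1 * expgz alpha (- n))%g <= K.
  rewrite orbit_distE //; apply: hK; move: An; rewrite /conj_by expgzN invgM invgK.
  by rewrite !mulgA.
have := descent p n1; have := descent q n2; rewrite /orbit_dist in middle *.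
set x1 := act (model_elt alpha p) o; set x2 := act (model_elt alpha q) o.
move: middle; set y1 := act _ o; set y2 := act _ o => h1 h2 h3.
have := metric_triangle x1 y1 x2; have := metric_triangle y1 y2 x2.
rewrite (metric_sym y2 x2).
have rho0 : 0 <= rho p q.
  by have [? ?] := merging_level_ge pair p q; rewrite /rho /model_dist; lra.
have : (2 * n%:~R + p.2%:~R + q.2%:~R) * mdist o (act alpha o) <=
    (rho p q + 2) * mdist o (act alpha o).
  by apply: ler_wpM2r => //; rewrite /rho /model_dist; lra.
have := mulr_ge0 K0 rho0; have := mulr_ge0 e0 rho0.
by lra.
Qed.

Definition base_ray o (n : nat) : X := act (alpha ^- n)%g o.

(** In the model, the product of the points [m] and [n] of the descending ray, seen
    from its origin, is the smaller of [m] and [n]; so it tends to infinity, and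
    so does the comparable product in [X]. *)
Lemma pair_hyperbolic o : hyperbolic_space X /\ gromov_sequence (base_ray o).
Proof.
have [delta rhoH] := model_dist_rough_hyperbolic pair.
have [r r0 hr] := pair_dense act_isom pair o act_cobounded.
have [N hN] := model_dist_step o (1 + 2 * r).
have [L0 L0_ge0 hL0] := model_dist_lower o.
pose f (p : model) := act (model_elt alpha p) o.
have N0 : 0 <= N%:R :> R by [].
have [||||| X_hyp [K hK]] := @hyperbolic_of_rough_model R X X_geodesic model rho f delta
  (L0 + 3 * N%:R) r rhoH.
- lra.
- by [].
- move=> p q; have := hL0 p q; rewrite /orbit_dist -/(f p) -/(f q).
  have rho0 : 0 <= rho p q by case: rhoH.
  by have := mulr_ge0 N0 rho0; lra.
- by move=> p q /hN; lra.
- move=> y; have [_ [[h z] /= dh <-] hy] := hr y.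
  by exists (exist _ h dh, z).
split=> //.
pose ray (n : nat) : model := (exist _ _ (@derived1 Gam), - n%:Z).
have ray_f n : f (ray n) = base_ray o n.
  by rewrite /f /model_elt /= mul1g expgzN.
have ray_le (m n : nat) : (m <= n)%N ->
    m%:R <= rough_product rho (ray 0%N) (ray m) (ray n).
  move=> mn.
  have lb (k : nat) : k%:R <= rho (ray k) (ray 0%N).
    have [q _] := merging_level_ge pair (ray k) (ray 0%N).
    move: q; rewrite /rho /model_dist /= !intrN /= oppr0.
    by rewrite -[k%:~R]/(k%:R); lra.
  have ub : rho (ray m) (ray n) <= n%:R - m%:R.
    have : merging_level R alpha A (ray m) (ray n) <= n%:Z%:~R.
      apply: (merging_level_le pair) => /=; [by lia | by lia|].
      by rewrite mulVg; exact: (sympart_phi1 A_conf n%:Z).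
    by rewrite /rho /model_dist /= !intrN; rewrite -[n%:~R]/(n%:R) -[m%:~R]/(m%:R); lra.
  by have := lb m; have := lb n; rewrite /rough_product; lra.
have grow (p : X) (m n : nat) : (m <= n)%N ->
    m%:R <= (`|K| + 1) *
      (gromov_product p (base_ray o m) (base_ray o n) + mdist o p + 1).
  move=> mn; apply: le_trans (ray_le m n mn) _; apply: le_trans (hK _ _ _) _.
  rewrite !ray_f; have -> : base_ray o 0 = o by rewrite /base_ray expg0 invg1 act1.
  set G := gromov_product _ _ _; set G' := gromov_product _ _ _.
  have G0 : 0 <= G.
    have := metric_triangle (base_ray o m) o (base_ray o n).
    by rewrite /G /gromov_product (metric_sym (base_ray o n) o); lra.
  have GG' : G <= G' + mdist o p.
    rewrite /G /G' /gromov_product.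
    have := metric_triangle (base_ray o m) p o.
    have := metric_triangle (base_ray o n) p o.
    by rewrite (metric_sym p o); lra.
  have q1 : K * G <= `|K| * G by apply: ler_wpM2r => //; exact: ler_norm.
  have q2 := ler_norm K.
  have : (`|K| + 1) * (G + 1) <= (`|K| + 1) * (G' + mdist o p + 1).
    by apply: ler_wpM2l; [apply: addr_ge0 | lra].
  by lra.
move=> p M.
pose B := (`|K| + 1) * (M + mdist o p + 1).
have K1 : 0 < `|K| + 1 by apply: ltr_wpDl.
have step (m n : nat) : ((Num.truncn B).+1 <= m)%N -> (m <= n)%N ->
    M <= gromov_product p (base_ray o m) (base_ray o n).
  move=> hm /(grow p) h.
  have hB : B <= m%:R.
    by apply/ltW/(lt_le_trans (truncnS_gt _)); rewrite ler_nat.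
  by have := le_trans hB h; rewrite /B ler_pM2l //; lra.
exists (Num.truncn B).+1 => m n hm hn.
have [mn|/ltnW nm] := leqP m n; first exact: step.
by rewrite gromov_productC; exact: step.
Qed.

Definition base_point o : set (nat -> X) :=
  [set v | gromov_sequence v /\ gromov_equiv (base_ray o) v].

Section BasePoint.
Variables (delta : R) (o : X).
Hypothesis hyp : hyperbolic_with X delta.

Let xi := base_point o.

Lemma base_point_boundary : gromov_boundary xi.
Proof. by exists (base_ray o) => //; case: (pair_hyperbolic o). Qed.

Lemma base_ray_mem : xi (base_ray o).
Proof. by case: (pair_hyperbolic o) => _ h; split. Qed.

Lemma fixes_base_point_of_near g (C : R) :
  (exists N : nat, forall n, (N <= n)%N ->
     mdist o (act (alpha ^+ n * g * alpha ^- n)%g o) <= C) ->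
  fixes_boundary_point act g xi.
Proof.
move=> [N hN]; apply: (fixes_of_equiv act_isom hyp base_point_boundary base_ray_mem).
apply: (@gromov_equiv_near _ _ C); first by case: (pair_hyperbolic o).
exists N => n /hN; rewrite /base_ray /= -(actM act_isom).
rewrite -[X in _ -> X <= _]/(orbit_dist act o (alpha ^- n)%g (g * alpha ^- n)%g).
by rewrite orbit_distE // invgK mulgA.
Qed.

Lemma derived_fixes_base_point h : derived h -> fixes_boundary_point act h xi.
Proof.
move=> dh; have [K K0 hK] := pair_displacement act_isom pair o.
have [N AN] := confining_absorbs A_conf dh.
apply: (@fixes_base_point_of_near _ K); exists N => n Nn; apply: hK.
by apply: (confining_mono A_conf (z := N) (z' := n)).
Qed.

Lemma alpha_fixes_base_point : fixes_boundary_point act alpha xi.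
Proof.
apply: (@fixes_base_point_of_near _ (mdist o (act alpha o))); exists 0%N => n _.
by rewrite -expgSr expgS mulgK.
Qed.

(** The level of [h o] is almost invariant under conjugation, and conjugation by a
    power of [alpha] brings [h] into [A], whose displacements are bounded. *)
Lemma derived_level_bounded k : horokernel xi k -> exists C : R,
  forall h, derived h -> `|k (o, act h o)| <= C.
Proof.
move=> hk; have [K K0 hK] := pair_displacement act_isom pair o.
exists (K + 6 * delta) => h dh; have [n An] := confining_absorbs A_conf dh.
have hxi := base_point_boundary.
have fn := fixesX act_isom n alpha_fixes_base_point.
have fh := derived_fixes_base_point dh.
have := horokernel_act_quasi act_isom hyp o (act (h * alpha ^- n)%g o) hxi hk fn.
have := horokernel_act_quasi act_isom hyp o (act (alpha ^- n)%g o) hxi hk fh.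
have := horokernel_act_quasi act_isom hyp o (act (alpha ^- n)%g o) hxi hk fn.
have := horokernel_le_dist o (act (alpha ^+ n * h * alpha ^- n)%g o) hk.
have := hK _ An; rewrite /conj_by expgz_nat -!(actM act_isom) !mulgA mulgV act1 //.
rewrite (horokernelxx o hk).
move=> ? /ler_normlP[? ?] /ler_normlP[? ?] /ler_normlP[? ?] /ler_normlP[? ?].
by apply/ler_normlP; split; lra.
Qed.

(** A second point fixed by the derived subgroup would bound its orbits, and
    [pair_proper] would then give an [N] for which conjugation by [alpha ^ N] maps
    the whole of it into [A]: so [A] would be its own image. *)
Lemma base_point_unique eta : gromov_boundary eta ->
  (forall h, derived h -> fixes_boundary_point act h eta) -> eta = xi.
Proof.
move=> heta feta; apply: contrapT => neq.
have hxi := base_point_boundary.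
have [k hk] := horokernel_exists hxi.
have [C hC] := derived_level_bounded hk.
have [|K hK] := displacement_bounded_of_fixes2 act_isom hyp o C hxi heta _ hk.
  by move=> /esym.
have [N hN] := pair_proper act_isom pair o K.
have AN h : derived h -> A (conj_by (expgz alpha N) h).
  move=> dh; have [|_ [An _]//] := hN h 0 dh.
  rewrite expgz0 mulg1; apply: hK; last exact: hC.
    exact: derived_fixes_base_point.
  exact: feta.
case: pair => _ _ [_ [_ AA]] _; apply: AA => a Aa.
exists (conj_by (expgz alpha (N%:Z + (Negz 0 - N%:Z))) a).
  rewrite expgzD conj_byM; apply: AN; apply: derived_conj_by.
  exact: confining_derived A_conf _ Aa.
by rewrite addrC subrK -conj_byM /= expg1 mulgV conj_by1.
Qed.

(** The derived subgroup is normal, so it fixes the translate of [xi] by [g] too. *)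
Lemma fixes_base_point g : fixes_boundary_point act g xi.
Proof.
apply: base_point_unique.
  exact: (translate_boundary act_isom g base_point_boundary).
move=> h dh; rewrite /fixes_boundary_point -!/(translate _ _ _).
rewrite -(translateM act_isom) conjgC (translateM act_isom); congr (translate _ _ _).
by apply: derived_fixes_base_point; exact: derivedJ.
Qed.

Lemma base_point_focal : exists beta, regular_focal_at act xi beta.
Proof.
have hxi := base_point_boundary.
have fxi : fixed_by_all act xi by split=> //; exact: fixes_base_point.
have [k hk] := horokernel_exists hxi.
have [C hC] := derived_level_bounded hk.
have [beta hb] := busemann_exists act_isom hyp hxi fixes_base_point.
have betaM := busemann_hom act_isom hyp hxi fixes_base_point hb hk hC.
exists beta; split=> //; split=> // [eta [heta feta]|].
  by apply: base_point_unique.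
have [s _ hs] : exists2 s, [set: Gam] s & delta < beta s.
  have [r r0 hr] := pair_dense act_isom pair o act_cobounded.
  apply: (busemann_unbounded act_isom X_geodesic hyp (o := o) _ fxi hb).
  by exists r => y; have [g _ hg] := hr y; exists g.
have hD n : `|k (o, act (s ^+ n)%g o) - n%:R * beta s| <= 2 * delta.
  exact: (busemann_close act_isom hyp hxi fixes_base_point).
have [D' hD'] := orbit_dist_linear act_isom hyp hk (ltW hs) hD.
have d0 : 0 <= delta by case: hyp.
exists s; exists (beta s); first by lra.
move=> x; apply: (@cvg_average _ _ _ (D' + 2 * mdist o x)) => n.
rewrite (iter_act act_isom); have /ler_normlP[? ?] := hD' n.
have := metric_triangle o x (act (s ^+ n)%g o).
have := metric_triangle x (act (s ^+ n)%g x) (act (s ^+ n)%g o).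
have := metric_triangle x o (act (s ^+ n)%g x).
have := metric_triangle o (act (s ^+ n)%g o) (act (s ^+ n)%g x).
rewrite !(act_dist act_isom) (metric_sym x o) => ? ? ? ?.
by apply/ler_normlP; split; lra.
Qed.

End BasePoint.

Lemma pair_regular_focal : hyperbolic_space X /\ regular_focal act.
Proof.
case: act_cobounded => o _; have [X_hyp _] := pair_hyperbolic o.
split=> //; case: X_hyp => delta d0 hd.
by have [beta hb] := base_point_focal o (conj d0 hd); exists (base_point o), beta.
Qed.

Lemma busemann_restriction xi (beta : Gam -> R) : regular_focal_at act xi beta ->
  exists2 c : R, c != 0 & forall h (n : int), derived h ->
    beta (h * expgz alpha n)%g = c * n%:~R.
Proof.
move=> [[fxi _ _] hb betaM]; case: act_cobounded => o _.
have [[delta d0 hd] _] := pair_hyperbolic o.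
have E h (n : int) : derived h -> beta (h * expgz alpha n)%g = beta alpha * n%:~R.
  by move=> dh; rewrite betaM (char_derived betaM dh) (char_expz betaM) add0r mulrC.
exists (beta alpha) => //.
have [r _ hr] := pair_dense act_isom pair o act_cobounded.
have [_ [[h z] /= dh <-]] :=
  busemann_unbounded act_isom X_geodesic (conj d0 hd) 0 fxi hb (ex_intro _ r hr).
rewrite E //; apply: contraL => /eqP ->.
by rewrite mul0r ltxx.
Qed.

End ConfiningImpliesFocal.

Theorem theorem4p1 (R : realType) (X : metricType R) (Gam : groupType)
  (act : Gam -> X -> X)
  (act_isom : isometric_action act)
  (act_cobounded : cobounded act)
  (X_geodesic : geodesic_space X) :
  ((hyperbolic_space X /\ regular_focal act) <->
     (exists (alpha : Gam) (A : set Gam), confining_pair act alpha A)) /\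
  (forall (alpha : Gam) (A : set Gam), confining_pair act alpha A ->
     (forall x : X, inclusion_qi act alpha A x) /\
     (forall (xi : set (nat -> X)) (beta : Gam -> R),
        regular_focal_at act xi beta ->
        exists2 c : R, c != 0 &
          forall (h : Gam) (n : int), derived h ->
            beta (h * expgz alpha n)%g = c * n%:~R)).
Proof.
split; [split|].
- move=> [[delta d0 hd] [xi [beta hreg]]].
  exact: (regular_focal_confining act_isom X_geodesic (conj d0 hd) act_cobounded hreg).
- move=> [alpha [A pair]].
  exact: (pair_regular_focal act_isom act_cobounded X_geodesic pair).
- move=> alpha A pair; split=> [x|xi beta].
    exact: (pair_inclusion_qi act_isom pair).
  exact: (busemann_restriction act_isom act_cobounded X_geodesic pair).
Qed.
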